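(* Let $(\Omega,\mathcal{F})$ be a standard Borel space. Then every countable Borel equivalence relation $E$ on $\Omega$ is strongly dualizable.
   Context: A countable Borel equivalence relation on a standard Borel space $(\Omega,\mathcal{F})$ is an equivalence relation $E\subseteq\Omega\times\Omega$ with $E\in\mathcal{F}\otimes\mathcal{F}$ all of whose equivalence classes are countable. Define $E^{\ast}:=\{A\in\mathcal{F}:\forall(\omega,\omega')\in E,\ (\omega\in A\Leftrightarrow\omega'\in A)\}$. $\mathcal{P}(\Omega,\mathcal{F})$ is the set of probability measures on $(\Omega,\mathcal{F})$, and $\Pi(\mathbb{P},\mathbb{P}')$ is the set of probability measures on $(\Omega\times\Omega,\mathcal{F}\otimes\mathcal{F})$ with marginals $\mathbb{P}$ and $\mathbb{P}'$. A pair $(E,\mathcal{G})$, with $\mathcal{G}$ a sub-$\sigma$-algebra of $\mathcal{F}$, satisfies strong duality if $E\in\mathcal{F}\otimes\mathcal{F}$ and, for all $\mathbb{P},\mathbb{P}'\in\mathcal{P}(\Omega,\mathcal{F})$, $$\max_{A\in\mathcal{G}}|\mathbb{P}(A)-\mathbb{P}'(A)|=\min_{\tilde{\mathbb{P}}\in\Pi(\mathbb{P},\mathbb{P}')}(1-\tilde{\mathbb{P}}(E)),$$ where max and min assert that the supremum and infimum are both attained. $E$ is strongly dualizable if $(E,E^{\ast})$ satisfies strong duality. *)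

(* Defs.v *)
From HB Require Import structures.
From mathcomp Require Import all_boot all_order all_algebra.
From mathcomp Require Import all_classical all_reals all_analysis.

Set Implicit Arguments.
Unset Strict Implicit.
Unset Printing Implicit Defensive.

Import Order.TTheory GRing.Theory Num.Theory.

Local Open Scope classical_set_scope.
Local Open Scope ring_scope.

Definition complete_metric (R : realType) (X : metricType R) : Prop :=
  forall F : set_system X, ProperFilter F -> cauchy F ->
    exists x : X, F --> x.

Definition separable_space (X : topologicalType) : Prop :=
  exists2 D : set X, countable D & dense D.

(* Standard Borel: isomorphic, as a measurable space, to a complete separable
   metric space with its Borel sigma-algebra. As [f] is bijective, the last
   clause says that both [f] and its inverse are measurable. *)
Definition standard_borel (R : realType) (d : measure_display)
    (T : measurableType d) : Prop :=
  exists (X : metricType R) (f : T -> X),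
    [/\ complete_metric X, separable_space X, bijective f &
        forall B : set X, <<s open >> B <-> measurable (f @^-1` B)].

Definition equivalence_relation (T : Type) (E : set (T * T)) : Prop :=
  [/\ forall x, E (x, x),
      forall x y, E (x, y) -> E (y, x) &
      forall x y z, E (x, y) -> E (y, z) -> E (x, z)].

(* [measurable] on [T * T] is the product sigma-algebra. *)
Definition countable_borel_equivalence (d : measure_display)
    (T : measurableType d) (E : set (T * T)) : Prop :=
  [/\ measurable E, equivalence_relation E &
      forall x, countable [set y | E (x, y)]].

Definition invariant_sets (d : measure_display) (T : measurableType d)
    (E : set (T * T)) : set (set T) :=
  [set A | measurable A /\ forall x y, E (x, y) -> (A x <-> A y)].

Definition couplings (R : realType) (d : measure_display)
    (T : measurableType d) (P P' : probability T R) :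
    set (probability (T * T)%type R) :=
  [set Q : probability (T * T)%type R | forall A : set T, measurable A ->
     pushforward Q fst A = P A /\ pushforward Q snd A = P' A].

Definition tv_values (R : realType) (d : measure_display)
    (T : measurableType d) (G : set (set T)) (P P' : probability T R) :
    set (\bar R) :=
  [set `|P A - P' A|%E | A in G].

Definition coupling_costs (R : realType) (d : measure_display)
    (T : measurableType d) (E : set (T * T)) (P P' : probability T R) :
    set (\bar R) :=
  [set (1 - Q E)%E | Q in couplings P P'].

(* The two membership clauses say that the supremum and the infimum are
   attained, i.e. that they are a maximum and a minimum. *)
Definition strong_duality (R : realType) (d : measure_display)
    (T : measurableType d) (E : set (T * T)) (G : set (set T)) : Prop :=
  [/\ sigma_algebra setT G, G `<=` measurable, measurable E &
      forall P P' : probability T R,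
        [/\ tv_values G P P' (ereal_sup (tv_values G P P')),
            coupling_costs E P P' (ereal_inf (coupling_costs E P P')) &
            ereal_sup (tv_values G P P') =
              ereal_inf (coupling_costs E P P')]].

Definition strongly_dualizable (R : realType) (d : measure_display)
    (T : measurableType d) (E : set (T * T)) : Prop :=
  strong_duality R E (invariant_sets E).

(* Main.v *)
Require Import Defs.
From HB Require Import structures.
From mathcomp Require Import all_boot all_order all_algebra.
From mathcomp Require Import all_classical all_reals all_analysis.
From mathcomp Require Import measurable_realfun lra.

(* A coupling of P and P' is built greedily.  If countably many measurable maps
   F n with graphs in E cover E, then at stage n one matches as much as possible
   of the residual mu of P with the residual nu of P' along the graph of F n: the
   image of mu under F n and nu have a greatest common submeasure theta, and a
   Radon-Nikodym density lifts theta to a submeasure of mu.  In the limit the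
   image of mu under each F n is singular to nu, so that nu lives on a set B whose
   E-saturation A is mu-null.  Thus P' A - P A is the mass of nu, which is the
   mass of the part of the coupling that may fall outside E.

   Such maps F n exist up to null sets, without the Lusin-Novikov theorem.  Write
   E as a Suslin scheme; its projections are measurable up to null sets
   (Marczewski).  A countable family F that minimizes the outer measures of the
   projections of the pieces of the scheme minus the graphs of F leaves, almost
   everywhere, pieces whose nonempty sections have at least two points.  A Cantor
   scheme then shows that a nonempty section would be uncountable.

   To get an exactly invariant set, the null sets are chosen null for a countable
   family of measures containing P + P' and closed under images by the selected
   maps: their E-saturations are again contained in such null sets. *)

Set Implicit Arguments.
Unset Strict Implicit.
Unset Printing Implicit Defensive.

Import Order.TTheory GRing.Theory Num.Theory.

Local Open Scope classical_set_scope.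
Local Open Scope ring_scope.

(** * Suslin schemes *)

Definition suslin_op (X : Type) (G : seq nat -> set X) : set X :=
  [set x | exists u : nat -> nat, forall n, G (mkseq u n) x].

Definition suslin (X : Type) (M : set (set X)) : set (set X) :=
  [set S | exists2 G : seq nat -> set X, (forall s, M (G s)) & S = suslin_op G].

(** Families indexed by pairs fit the nodes built in [suslin_bigcap], which impose one condition per
    scheme and length. The empty index set yields [setT]. *)
Definition countable_bigcap_closed (X : Type) (M : set (set X)) :=
  forall (D : set (nat * nat)) (F : nat * nat -> set X),
    (forall p, M (F p)) -> M (\bigcap_(p in D) F p).

Lemma mkseq_cons (u : nat -> nat) (n : nat) :
  mkseq u n.+1 = u 0%N :: mkseq (fun k => u k.+1) n.
Proof.
rewrite /mkseq /= -[1%N]addn0 iotaDl -map_comp.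
by congr cons; apply: eq_map => k /=; rewrite add1n.
Qed.

Lemma mkseq_rcons (u : nat -> nat) (n : nat) :
  mkseq u n.+1 = rcons (mkseq u n) (u n).
Proof. by rewrite /mkseq -addn1 iotaD map_cat /= cats1. Qed.

Lemma sub_suslin (X : Type) (M : set (set X)) : M `<=` suslin M.
Proof.
move=> A MA; exists (fun=> A) => //.
by apply/seteqP; split => [x Ax|x [u /(_ 0%N)]//]; exists (fun=> 0%N).
Qed.

Lemma suslin_bigcup (X : Type) (M : set (set X)) (S : nat -> set X) :
  countable_bigcap_closed M -> (forall i, suslin M (S i)) ->
  suslin M (\bigcup_i S i).
Proof.
move=> MI MS.
have MT : M setT.
  have [G MG _] := MS 0%N.
  rewrite -(@bigcap_set0 X (nat * nat)%type (fun=> G [::])).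
  exact: MI.
have /choice[G GP] : forall i, exists G, (forall s, M (G s)) /\ S i = suslin_op G.
  by move=> i; have [G ? ?] := MS i; exists G.
(* The first entry of a branch selects the set of the union, the remaining ones form a branch of its
   scheme, and the root imposes nothing. *)
exists (fun s => if s is i :: s' then G i s' else setT).
  by case=> // i s; have [] := GP i.
apply/seteqP; split => [x [i _]|x [u ux]].
- have [_ ->] := GP i => -[u ux].
  exists (fun k => if k is k'.+1 then u k' else i) => -[|n]; first by [].
  by rewrite mkseq_cons; exact: ux.
- exists (u 0%N) => //; have [_ ->] := GP (u 0%N).
  exists (fun k => u k.+1) => n.
  by move: (ux n.+1); rewrite mkseq_cons.
Qed.

(* A branch for the intersection interleaves branches [fun m => u (pair i m)]
   of the individual schemes; a node of length [k] imposes the conditions that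
   are already decided by its first [k] entries. *)
Lemma suslin_bigcap (X : Type) (M : set (set X)) (S : nat -> set X) :
  countable_bigcap_closed M -> (forall i, suslin M (S i)) ->
  suslin M (\bigcap_i S i).
Proof.
move=> MI MS.
have /choice[G GP] : forall i, exists G, (forall s, M (G s)) /\ S i = suslin_op G.
  by move=> i; have [G ? ?] := MS i; exists G.
pose code (i m : nat) : nat := pickle (i, m).
pose H (s : seq nat) := \bigcap_(p in [set p : nat * nat |
    forall m, (m < p.2)%N -> (code p.1 m < size s)%N])
  G p.1 (mkseq (fun m => nth 0%N s (code p.1 m)) p.2).
exists H.
  by move=> s; apply: MI => p; have [] := GP p.1.
apply/seteqP; split => [x Sx|x [u ux] i _].
- have /choice[u uP] : forall i, exists u, forall n, G i (mkseq u n) x.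
    by move=> i; have := Sx i Logic.I; have [_ ->] := GP i.
  exists (fun k => if unpickle k is Some (i, m) then u i m else 0%N) => n.
  move=> [i k] /= ik.
  rewrite (_ : mkseq _ k = mkseq (u i) k); first exact: uP.
  apply: (@eq_from_nth _ 0%N); rewrite !size_mkseq // => m mk.
  rewrite !nth_mkseq //; first by rewrite /code pickleK.
  by have := ik m mk; rewrite size_mkseq.
- have [_ ->] := GP i.
  exists (fun m => u (code i m)) => n.
  pose N := (\sum_(m < n) (code i m).+1)%N.
  have cN m : (m < n)%N -> (code i m < N)%N.
    move=> mn; rewrite /N (bigD1 (Ordinal mn)) //= addSn ltnS leq_addr //.
  have /= := ux N (i, n); rewrite size_mkseq => /(_ cN).
  congr (G i _ x); apply: (@eq_from_nth _ 0%N); rewrite !size_mkseq // => m mn.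
  by rewrite !nth_mkseq // cN.
Qed.

Lemma suslin_setI (X : Type) (M : set (set X)) (A B : set X) :
  countable_bigcap_closed M -> suslin M A -> suslin M B -> suslin M (A `&` B).
Proof.
move=> MI MA MB; rewrite (_ : A `&` B =
    \bigcap_i (fun i => if i is 0%N then A else B) i).
  by apply: suslin_bigcap => // -[].
apply/seteqP; split => [x [Ax Bx] [|i]//|x ABx].
by split; [exact: (ABx 0%N)|exact: (ABx 1%N)].
Qed.

Lemma suslin_tail (X : Type) (G : seq nat -> set X) (s : seq nat) :
  suslin_op (fun t => G (s ++ t)) `<=`
  \bigcup_i suslin_op (fun t => G (rcons s i ++ t)).
Proof.
move=> x [u ux]; exists (u 0%N) => //; exists (fun k => u k.+1) => n.
by have := ux n.+1; rewrite mkseq_cons cat_rcons.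
Qed.

Lemma branch_ex (Q : seq nat -> Prop) : Q [::] ->
  (forall s, Q s -> exists i, Q (rcons s i)) ->
  exists u, forall n, Q (mkseq u n).
Proof.
move=> Q0 QS.
have /choice[pk pkP] : forall s, exists i, Q s -> Q (rcons s i).
  move=> s; have [/QS[i Qi]|nQ] := pselect (Q s); first by exists i.
  by exists 0%N.
pose node := fix node n := if n is m.+1 then rcons (node m) (pk (node m))
             else [::].
have nodeE n : node n = mkseq (fun k => pk (node k)) n.
  by elim: n => // n IH; rewrite mkseq_rcons -IH.
exists (fun k => pk (node k)) => n; rewrite -nodeE.
by elim: n => //= n IH; exact: pkP.
Qed.

(** Exhaustion principle: [op] turns a minimizing sequence into one element lying below all its
    members. It serves both for measurable hulls and for optimal families of selectors. *)
Lemma inf_attained (R : realType) (A : Type) (a0 : A) (v : A -> \bar R)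
    (op : (nat -> A) -> A) : (forall f n, (v (op f) <= v (f n))%E) ->
  exists a, forall b, (v a <= v b)%E.
Proof.
move=> vop.
have v0 : range v != set0 by apply/set0P; exists (v a0), a0.
have [u uv ul] := ereal_inf_seq v0.
have /choice[w wP] : forall n, exists a, v a = u n.
  by move=> n; have [a _ <-] := uv n; exists a.
exists (op w) => b.
apply: (@le_trans _ _ (ereal_inf (range v))); last first.
  by apply: ereal_inf_lbound; exists b.
have := cvg_lim (@ereal_hausdorff R) ul => <-.
apply: lime_ge; first by apply/cvg_ex; exists (ereal_inf (range v)).
by apply: nearW => n; rewrite -wP.
Qed.

(** * Measurable hulls and Marczewski's theorem *)

Section hull.
Context d (T : measurableType d) (R : realType).
Variable mu : {finite_measure set T -> \bar R}.
Local Open Scope ereal_scope.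

(** Take a measurable superset [B] of least measure. For a competitor [C] the set [B] meet [C] is
    again a candidate, so removing [C] from [B] leaves a null set. *)
Lemma measurable_hull (S : set T) : exists B, [/\ measurable B, S `<=` B &
  forall C, measurable C -> S `<=` C -> mu (B `\` C) = 0].
Proof.
pose A := {B : set T | measurable B /\ S `<=` B}.
pose op (F : nat -> A) : A := exist _ (\bigcap_n sval (F n))
  (conj (bigcapT_measurable (fun n => proj1 (svalP (F n))))
     (fun x Sx n _ => proj2 (svalP (F n)) x Sx)).
have [|[B [mB SB]] Bmin] :=
    @inf_attained R A (exist _ setT (conj measurableT (@subsetT _ S)))
      (fun B => mu (sval B)) op.
  move=> F n; apply: le_measure; rewrite ?inE.
  - by apply: bigcapT_measurable => k; exact: (proj1 (svalP (F k))).
  - exact: (proj1 (svalP (F n))).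
  - exact: bigcap_inf.
exists B; split => // C mC SC.
have mBC : measurable (B `&` C) by exact: measurableI.
have := Bmin (exist _ (B `&` C) (conj mBC (fun x Sx => conj (SB x Sx) (SC x Sx)))).
rewrite /= => le.
rewrite measureD //; last first.
  by rewrite ltey_eq fin_num_measure.
apply/eqP; rewrite eq_le; apply/andP; split.
  by rewrite sube_le0.
by rewrite sube_ge0 ?measureIl // fin_num_measure.
Qed.

(** [S s] collects the points with a branch through [s], and [B s] is a hull of it inside [G s]. The
    part [W s] of [B s] missed by the hulls at the children is null. Off the union of these
    countably many null sets, a point of the root hull can be followed down a branch. *)
Lemma suslin_op_measurable (G : seq nat -> set T) :
  (forall s, measurable (G s)) ->
  exists Q N, [/\ measurable Q, measurable N, mu N = 0,
    Q `<=` suslin_op G & suslin_op G `<=` Q `|` N].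
Proof.
move=> mG.
pose S s := suslin_op (fun t => G (s ++ t)).
have /choice[B0 B0P] s := measurable_hull (S s).
pose B s := B0 s `&` G s.
have mB s : measurable (B s) by apply: measurableI => //; have [] := B0P s.
have SG s : S s `<=` G s by move=> x [u /(_ 0%N)]; rewrite cats0.
have SB s : S s `<=` B s.
  by move=> x Sx; split; [have [_ sub _] := B0P s; exact: sub|exact: SG].
have BC s C : measurable C -> S s `<=` C -> mu (B s `\` C) = 0.
  move=> mC SC; have [mB0 _ /(_ C mC SC)] := B0P s.
  apply: subset_measure0 => //; [exact: measurableD..|].
  by apply: setSD; exact: subIsetl.
pose W s := B s `\` \bigcup_i B (rcons s i).
have mW s : measurable (W s).
  by apply: measurableD => //; exact: bigcup_measurable.
have W0 s : mu (W s) = 0.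
  apply: BC; first exact: bigcup_measurable.
  by move=> x Sx; have [i _ Si] := suslin_tail Sx; exists i => //; exact: SB.
pose N := \bigcup_n W (CodeSeq.decode n).
have mN : measurable N by exact: bigcup_measurable.
have N0 : mu N = 0.
  apply/negligibleP => //; apply: negligible_bigcup => n.
  by apply/(negligibleP _ (mW _)); exact: W0.
exists (B [::] `\` N), N; split => //.
- exact: measurableD.
- move=> x [Bx Nx].
  have [|u uP] := @branch_ex (fun s => B s x) Bx.
    move=> s Bs; apply: contrapT => nB; apply: Nx.
    exists (CodeSeq.code s) => //; rewrite CodeSeq.codeK; split => // -[i _ Bi].
    by apply: nB; exists i.
  by exists u => n; have [] := uP n.
- move=> x Sx; have [?|?] := pselect (N x); first by right.
  by left; split => //; exact: SB.
Qed.

End hull.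

(** * Suslin sets in a product *)

(* [c n i] stands for the closed ball of radius [1 / (n + 1)] around the [i]-th
   point of a countable dense subset of a Polish space, and [cl] for the closed
   sets; no topology is put on [T] itself. *)
Record polish_base d (T : measurableType d) (c : nat -> nat -> set T)
    (cl : set (set T)) : Prop := PolishBase {
  pb_measurable : forall n i, measurable (c n i) ;
  pb_generate :
    measurable = <<s [set A | exists n i, A = c n i] >> ;
  pb_cover : forall n y, exists i, c n i y ;
  pb_separate : forall y z, y <> z ->
    exists n, forall i, c n i y -> ~ c n i z ;
  pb_closed : forall n i, cl (c n i) ;
  pb_setC : forall n i, exists2 a : nat -> set T,
    (forall k, cl (a k)) & ~` c n i = \bigcup_k a k ;
  pb_bigcap : forall (I : Type) (D : set I) (F : I -> set T),
    (forall i, D i -> cl (F i)) -> cl (\bigcap_(i in D) F i) ;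
  pb_complete : forall F : nat -> set T, (forall n, cl (F n)) ->
    (forall n, F n.+1 `<=` F n) -> (forall n, F n !=set0) ->
    (forall n, exists i, F n.+1 `<=` c n i) -> \bigcap_n F n !=set0 }.

Lemma pair_bigcap_measurable d (T : measurableType d) (D : set (nat * nat))
    (F : nat * nat -> set T) :
  (forall p, measurable (F p)) -> measurable (\bigcap_(p in D) F p).
Proof.
move=> mF; rewrite -[X in measurable X]setCK setC_bigcap.
apply: measurableC; rewrite bigcup_mkcond.
apply: countable_bigcupT_measurable; first exact: countableP.
by move=> p; case: ifP => // _; exact: measurableC.
Qed.

Section product.
Context d (T : measurableType d) (c : nat -> nat -> set T) (cl : set (set T)).
Hypothesis pb : polish_base c cl.

(** The first side need only be measurable, since projections go to the first factor; the second is
    closed so that completeness can produce a point of the section. *)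
Definition rectangle : set (set (T * T)) :=
  [set A `*` K | A in measurable & K in cl].

Lemma cl_setT : cl setT.
Proof.
rewrite -(@bigcap_set0 T nat (fun=> set0)).
by apply: (pb_bigcap pb).
Qed.

Lemma rectangle_bigcap : countable_bigcap_closed rectangle.
Proof.
move=> D F RF.
have /choice[AK AKP] : forall p, exists AK : set T * set T,
    [/\ measurable AK.1, cl AK.2 & F p = AK.1 `*` AK.2].
  by move=> p; have [A mA [K cK <-]] := RF p; exists (A, K).
exists (\bigcap_(p in D) (AK p).1).
  by apply: pair_bigcap_measurable => p; have [] := AKP p.
exists (\bigcap_(p in D) (AK p).2).
  by apply: (pb_bigcap pb) => p _; have [] := AKP p.
apply/seteqP; split => [x [x1 x2] p Dp|x Fx].
  by have [_ _ ->] := AKP p; split; [exact: x1|exact: x2].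
by split => p Dp; have := Fx p Dp; have [_ _ ->] := AKP p => -[].
Qed.

Lemma rectangleX (A K : set T) : measurable A -> cl K -> rectangle (A `*` K).
Proof. by move=> mA cK; exists A => //; exists K. Qed.

(** Suslin sets need not be closed under complements, so the induction over the product
    sigma-algebra runs through the sets that are Suslin together with their complement. *)
Let bisuslin : set (set (T * T)) :=
  [set S | suslin rectangle S /\ suslin rectangle (~` S)].

Let bisuslin_sigma_algebra : sigma_algebra setT bisuslin.
Proof.
split.
- split; first by apply: sub_suslin; rewrite -(@set0X _ T setT);
    apply: rectangleX => //; exact: cl_setT.
  rewrite setC0 -setXTT.
  by apply: sub_suslin; apply: rectangleX => //; exact: cl_setT.
- by move=> A [SA SCA]; rewrite /bisuslin /= setTD setCK.
- move=> F SF; split.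
    by apply: suslin_bigcup; [exact: rectangle_bigcap|move=> i; have [] := SF i].
  rewrite setC_bigcup.
  by apply: suslin_bigcap; [exact: rectangle_bigcap|move=> i; have [] := SF i].
Qed.

Lemma measurable_suslin : measurable `<=` suslin rectangle.
Proof.
suff H : (measurable : set (set (T * T))) `<=` bisuslin by move=> S /H[].
apply: smallest_sub => // S [[A mA <-]|[B mB <-]]; rewrite setTI.
- split; apply: sub_suslin.
    by rewrite -setXT; apply: rectangleX => //; exact: cl_setT.
  rewrite preimage_setC -setXT.
  by apply: rectangleX; [exact: measurableC|exact: cl_setT].
- move: B mB; rewrite (pb_generate pb).
  apply: (@smallest_sub _ _ _ [set B | bisuslin (snd @^-1` B)]).
    have [B0 BD BU] := bisuslin_sigma_algebra.
    split => [|A /BD|F /BU].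
    + by rewrite /= preimage_set0.
    + by rewrite /= !setTD preimage_setC.
    + by rewrite /= preimage_bigcup.
  move=> _ [n [i ->]]; split.
    apply: sub_suslin; rewrite -setTX; apply: rectangleX => //.
    exact: (pb_closed pb).
  have [a cla aE] := pb_setC pb n i.
  rewrite preimage_setC aE preimage_bigcup.
  apply: suslin_bigcup; first exact: rectangle_bigcap.
  by move=> k; apply: sub_suslin; rewrite -setTX; exact: rectangleX.
Qed.

(** Along a branch the sets [K] decrease, are closed and have vanishing diameter, which is what
    [pb_complete] asks for. *)
Definition regular_scheme (A K : seq nat -> set T) : Prop :=
  [/\ forall s, measurable (A s), forall s, cl (K s),
      forall s i, A (rcons s i) `<=` A s, forall s i, K (rcons s i) `<=` K s &
      forall s m, (m < size s)%N -> exists i, K s `<=` c m i].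

(** An entry of the new branch encodes a pair: an entry of the old branch and the index of a small
    set containing the second coordinate. Intersecting over all initial segments of a node makes the
    scheme decreasing. *)
Lemma suslin_regular_scheme (S : set (T * T)) : suslin rectangle S ->
  exists A K, regular_scheme A K /\ S = suslin_op (fun s => A s `*` K s).
Proof.
move=> [G RG SE].
have /choice[AK AKP] : forall s, exists AK : set T * set T,
    [/\ measurable AK.1, cl AK.2 & G s = AK.1 `*` AK.2].
  by move=> s; have [A mA [K cK <-]] := RG s; exists (A, K).
(* Numbers that encode no pair are read as [(0, 0)], which only duplicates branches. *)
pose p (k : nat) : nat * nat := odflt (0%N, 0%N) (unpickle k).
pose pre (s : seq nat) m := map (fun k => (p k).1) (take m s).
pose A s := \bigcap_(m in [set m | (m <= size s)%N]) (AK (pre s m)).1.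
pose K1 s := \bigcap_(m in [set m | (m <= size s)%N]) (AK (pre s m)).2.
pose K2 s := \bigcap_(m in [set m | (m < size s)%N]) c m (p (nth 0%N s m)).2.
(* The intersection is taken over [bool] because [pb_bigcap] is about indexed families. *)
pose K s := \bigcap_(b in [set: bool]) (if b then K1 s else K2 s).
have KE s x : K s x <-> K1 s x /\ K2 s x.
  by split=> [Kx|[? ?] []//]; split; [exact: (Kx true)|exact: (Kx false)].
have pre_rcons s i m : (m <= size s)%N -> pre (rcons s i) m = pre s m.
  by move=> ms; rewrite /pre -cats1 takel_cat.
exists A, K; split; first split.
- move=> s; apply: bigcap_measurableType => m _.
  by have [] := AKP (pre s m).
- move=> s; apply: (pb_bigcap pb) => -[] _; apply: (pb_bigcap pb) => m _.
    by have [] := AKP (pre s m).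
  exact: (pb_closed pb).
- move=> s i x Ax m /= ms; rewrite -(pre_rcons s i) //.
  by apply: Ax; rewrite /= size_rcons leqW.
- move=> s i x /KE[K1x K2x]; apply/KE; split => m /= ms.
    rewrite -(pre_rcons s i) //.
    by apply: K1x; rewrite /= size_rcons leqW.
  have := K2x m; rewrite /= size_rcons nth_rcons ms; apply.
  exact: leqW.
- move=> s m ms; exists (p (nth 0%N s m)).2 => x /KE[_]; exact.
have pre_mkseq u n m : (m <= n)%N ->
    pre (mkseq u n) m = mkseq (fun k => (p (u k)).1) m.
  move=> mn; rewrite /pre /mkseq -map_take -map_comp; congr map.
  by rewrite take_iota (minn_idPl mn).
apply/seteqP; split => [[x y]|[x y] [u uxy]].
- rewrite SE => -[u uxy].
  have /choice[v vP] : forall n, exists i, c n i y by move=> n; exact: (pb_cover pb).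
  exists (fun k => pickle (u k, v k)) => n.
  have puv k : p (pickle (u k, v k)) = (u k, v k) by rewrite /p pickleK.
  have preE m : (m <= n)%N ->
      pre (mkseq (fun k => pickle (u k, v k)) n) m = mkseq u m.
    move=> mn; rewrite pre_mkseq //; apply: eq_mkseq => k.
    by rewrite puv.
  split => /=.
    move=> m; rewrite /= size_mkseq => mn; rewrite preE //.
    by have := uxy m; have [_ _ ->] := AKP (mkseq u m) => -[].
  apply/KE; split.
    move=> m; rewrite /= size_mkseq => mn; rewrite preE //.
    by have := uxy m; have [_ _ ->] := AKP (mkseq u m) => -[].
  move=> m; rewrite /= size_mkseq => mn; rewrite nth_mkseq // puv.
  exact: vP.
- rewrite SE; exists (fun k => (p (u k)).1) => n.
  have [_ _ ->] := AKP (mkseq (fun k => (p (u k)).1) n).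
  have [/= Ax /KE[Ky _]] := uxy n.
  rewrite -(@pre_mkseq u n n) //; split.
    by apply: Ax; rewrite /= size_mkseq.
  by apply: Ky; rewrite /= size_mkseq.
Qed.

Lemma regular_scheme_section (A K : seq nat -> set T) x (u : nat -> nat) :
  regular_scheme A K -> (forall n, A (mkseq u n) x) ->
  (forall n, K (mkseq u n) !=set0) ->
  exists2 y, (forall n, K (mkseq u n) y) &
    suslin_op (fun s => A s `*` K s) (x, y).
Proof.
move=> [mA cK dA dK sK] Ax K0.
have [|||y yK] := pb_complete pb (fun n => cK (mkseq u n)).
- by move=> n; rewrite mkseq_rcons; exact: dK.
- exact: K0.
- by move=> n; apply: sK; rewrite size_mkseq.
exists y => [n|]; first exact: yK.
by exists u => n; split; [exact: Ax|exact: yK].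
Qed.

(** By completeness a branch contributes to the section over [x] as soon as all its sets [K] are
    nonempty. So the projection is the Suslin operation applied to [G], where [G s] is [A s] or
    empty according to [K s], and Marczewski's theorem applies. *)
Lemma suslin_projection (R : realType) (mu : {finite_measure set T -> \bar R})
    (S : set (T * T)) : suslin rectangle S ->
  exists Q N, [/\ measurable Q, measurable N, mu N = 0%E,
    Q `<=` fst @` S & fst @` S `<=` Q `|` N].
Proof.
move=> /suslin_regular_scheme[A [K [rAK SE]]].
pose G s := A s `&` [set _ | K s !=set0].
have mG s : measurable (G s).
  apply: measurableI; first by case: rAK.
  have [K0|K0] := pselect (K s !=set0).
    by rewrite (_ : [set _ | _] = setT) //; apply/seteqP; split.
  by rewrite (_ : [set _ | _] = set0) //; apply/seteqP; split.
have -> : fst @` S = suslin_op G.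
  apply/seteqP; split => [x [[x' y]]|x [u ux]].
    rewrite SE => -[u uxy] /= <-; exists u => n.
    by have [/= Ax Ky] := uxy n; split => //; exists y.
  have [||y _ Sxy] := @regular_scheme_section A K x u rAK.
  - by move=> n; have [] := ux n.
  - by move=> n; have [] := ux n.
  by exists (x, y) => //; rewrite SE.
exact: suslin_op_measurable.
Qed.

(** A pair lies off the graph exactly when some small set contains [g x] but not [y]. *)
Lemma graph_measurable (g : T -> T) : measurable_fun setT g ->
  measurable [set p : T * T | p.2 = g p.1].
Proof.
move=> mg; rewrite -[X in measurable X]setCK; apply: measurableC.
rewrite (_ : ~` _ = \bigcup_n \bigcup_i ((g @^-1` c n i) `*` ~` c n i)).
  apply: bigcup_measurable => n _; apply: bigcup_measurable => i _.
  apply: measurableX; last exact/measurableC/(pb_measurable pb).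
  by rewrite -[X in measurable X]setTI; apply: mg => //; exact: (pb_measurable pb).
apply/seteqP; split => [[x y] /= yx|[x y] [n _ [i _ [/= gx yc]]] /= yE].
  have [|n nP] := @pb_separate _ _ _ _ pb (g x) y; first by move=> E; exact: yx.
  have [i ci] := pb_cover pb n (g x).
  by exists n => //; exists i => //; split => //=; exact: nP.
by apply: yc; rewrite yE.
Qed.

End product.

(** * Standard Borel spaces *)

Lemma natSinv_lt (R : realType) (e : R) : 0 < e -> exists n, (n.+1%:R^-1 : R) < e.
Proof. by move=> /ltr_add_invr[n]; rewrite add0r; exists n. Qed.

Section small_sets.
Context (R : realType) (X : metricType R) (D : set X) (h : X -> nat).
Hypothesis dD : dense D.
Hypothesis hinj : {in D &, injective h}.

(* A closed ball around the point of [D] with number [i]; empty if there is no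
   such point. *)
Definition small_set (n i : nat) : set X :=
  [set z | exists e, [/\ D e, h e = i & mdist e z <= n.+1%:R^-1]].

Lemma small_set_cover n z : exists i, small_set n i z.
Proof.
have r0 : 0 < (n.+1%:R^-1 : R) by rewrite invr_gt0 ltr0n.
have [|e [eb De]] := dD _ (open_nbhs_ball z (PosNum r0)).1.
  exists z; exact: (open_nbhs_ball z (PosNum r0)).2.
exists (h e), e; split => //.
have := interior_subset eb; rewrite /= ballEmdist /= metric_sym => /ltW.
exact.
Qed.

Lemma small_set_mdist n i y z : small_set n i y -> small_set n i z ->
  mdist y z <= n.+1%:R^-1 + n.+1%:R^-1.
Proof.
move=> [e [De he ey]] [e' [De' he' ez]].
have ee' : e' = e by apply: hinj; rewrite ?inE ?he ?he'.
rewrite {}ee' in ez; apply: (le_trans (metric_triangle y e z)).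
by rewrite lerD // metric_sym.
Qed.

Lemma closed_mdist_le (e : X) (r : R) : closed [set z | mdist e z <= r].
Proof.
rewrite -[X in closed X]setCK; apply: open_closedC.
rewrite openE => z /= /negP; rewrite -ltNge => rz.
have d0 : 0 < mdist e z - r by rewrite subr_gt0.
apply/nbhs_ballP; exists (mdist e z - r) => //= w.
rewrite ballEmdist /= => zw; apply/negP; rewrite -ltNge.
have := metric_triangle e w z; rewrite (metric_sym w z) => tri.
by lra.
Qed.

Lemma closed_small_set n i : closed (small_set n i).
Proof.
have [[e [De he]]|nex] := pselect (exists e, D e /\ h e = i).
  rewrite (_ : small_set n i = [set z | mdist e z <= n.+1%:R^-1]).
    exact: closed_mdist_le.
  apply/seteqP; split => z /=; last by exists e.
  move=> [e' [De' he' ez]].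
  by rewrite -(_ : e' = e) //; apply: hinj; rewrite ?inE ?he ?he'.
rewrite (_ : small_set n i = set0); first exact: closed0.
apply/seteqP; split => z //= -[e [De he _]].
by apply: nex; exists e.
Qed.

Lemma open_small_sets (U : set X) : open U ->
  U = \bigcup_n \bigcup_i
        (if `[< small_set n i `<=` U >] then small_set n i else set0).
Proof.
rewrite openE => oU; apply/seteqP; split => [z Uz|z [n _ [i _]]].
  have /nbhs_ballP[r /= r0 rU] := oU z Uz.
  (* Half of [r], because two points of a small set may be twice its radius apart. *)
  have [|n nr] := @natSinv_lt R (r / 2); first by rewrite divr_gt0.
  have [i iz] := small_set_cover n z.
  exists n => //; exists i => //; case: ifPn => // /asboolP; apply.
  move=> w iw; apply: rU; rewrite ballEmdist /=.
  by apply: (le_lt_trans (small_set_mdist iz iw)); rewrite [ltRHS]splitr ltrD.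
by case: ifPn => // /asboolP; apply.
Qed.

End small_sets.

Lemma standard_borel_polish_base (R : realType) d (T : measurableType d) :
  standard_borel R T -> exists c cl, polish_base (T := T) c cl.
Proof.
move=> [X [f [complX [D cD dD] [g fK gK] mE]]].
have /countable_injP[h hinj] := cD.
pose c n i := f @^-1` small_set D h n i.
pose cl := [set K : set T | exists2 C, closed C & K = f @^-1` C].
have clc n i : cl (c n i).
  by exists (small_set D h n i) => //; exact: (closed_small_set hinj).
have openc (U : set X) : open U -> f @^-1` U =
    \bigcup_n \bigcup_i (if `[< small_set D h n i `<=` U >] then c n i else set0).
  move=> oU; rewrite [in LHS](open_small_sets dD hinj oU) preimage_bigcup.
  apply: eq_bigcupr => n _; rewrite preimage_bigcup; apply: eq_bigcupr => i _.
  by case: ifP => // _; rewrite preimage_set0.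
have mclosed (C : set X) : closed C -> measurable (f @^-1` C).
  move=> cC; apply/mE; rewrite -[C]setCK -setTD; apply: sigma_algebraCD.
  by apply: sub_sigma_algebra; exact: closed_openC.
have mc n i : measurable (c n i) by apply: mclosed; exact: (closed_small_set hinj).
exists c, cl; split => //.
- apply/seteqP; split; last first.
    apply: smallest_sub; first exact: sigma_algebra_measurable.
    by move=> _ [n [i ->]].
  move=> A mA; have Afg : A = f @^-1` (g @^-1` A).
    by apply/seteqP; split => x /=; rewrite fK.
  rewrite Afg in mA *; move/mE : mA.
  apply: (@smallest_sub _ _ _
    [set B | <<s [set A0 | exists n i, A0 = c n i] >> (f @^-1` B)]).
    split => [|B /= GB|F GF] /=.
    + by rewrite preimage_set0; exact: sigma_algebra0.
    + by rewrite setTD -preimage_setC -setTD; exact: sigma_algebraCD.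
    + by rewrite preimage_bigcup; exact: sigma_algebra_bigcup.
  move=> U oU /=; rewrite openc //.
  apply: sigma_algebra_bigcup => n; apply: sigma_algebra_bigcup => i.
  case: ifP => _; last exact: sigma_algebra0.
  by apply: sub_sigma_algebra; exists n, i.
- by move=> n y; exact: (small_set_cover h dD).
- move=> y z yz.
  have yz0 : 0 < mdist (f y) (f z).
    by rewrite mdist_gt0; apply/eqP => /(can_inj fK).
  have [|n nr] := @natSinv_lt R (mdist (f y) (f z) / 2); first by rewrite divr_gt0.
  exists n => i iy iz; have le := small_set_mdist hinj iy iz.
  by have := le_lt_trans le (ltrD nr nr); rewrite -splitr ltxx.
- move=> n i; pose U := ~` small_set D h n i.
  pose a k := let p := odflt (0%N, 0%N) (unpickle k) in
    if `[< small_set D h p.1 p.2 `<=` U >] then c p.1 p.2 else set0.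
  exists a.
    move=> k; rewrite /a /=; case: ifP => // _.
    by exists set0; rewrite ?preimage_set0 //; exact: closed0.
  rewrite [LHS]preimage_setC openc; last first.
    by apply: closed_openC; exact: (closed_small_set hinj).
  apply/seteqP; split => [y [k _ [j _ kj]]|y [k _]]; last first.
    rewrite /a; set p := odflt _ _ => akx.
    by exists p.1 => //; exists p.2.
  by exists (pickle (k, j)) => //; rewrite /a pickleK.
- move=> I J F clF.
  have /choice[C CP] : forall i, exists C, closed C /\ (J i -> F i = f @^-1` C).
    move=> i; have [/clF[C ? ?]|nJ] := pselect (J i); first by exists C.
    by exists set0; split => //; exact: closed0.
  exists (\bigcap_(i in J) C i); first by apply: closed_bigI => i _; have [] := CP i.
  by rewrite preimage_bigcap; apply: eq_bigcapr => i Ji; exact: (CP i).2.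
- move=> F clF dF F0 sF.
  have /choice[C CP] : forall n, exists C, closed C /\ F n = f @^-1` C.
    by move=> n; have [C ? ?] := clF n; exists C.
  have le_F m n : (m <= n)%N -> F n `<=` F m.
    move=> mn; rewrite -(subnKC mn).
    elim: (n - m)%N => [|k IH]; first by rewrite addn0.
    by rewrite addnS; exact: subset_trans (dF _) IH.
  (* The images of the sets [F n] generate a Cauchy filter, as [F n.+1] lies in a small set of index
     [n]. Its limit belongs to every closed set [C n]. *)
  pose G : set_system X := [set A | exists n, f @` F n `<=` A].
  have GF : Filter G.
    split.
    - by exists 0%N.
    - move=> A B [m mA] [n nB]; exists (maxn m n) => _ [y Fy <-]; split.
        by apply: mA; exists y => //; exact: le_F (leq_maxl _ _) _ Fy.
      by apply: nB; exists y => //; exact: le_F (leq_maxr _ _) _ Fy.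
    - by move=> A B AB [n nA]; exists n; exact: subset_trans nA AB.
  have GP : ProperFilter G.
    split=> //; move=> [n nG]; have [y Fy] := F0 n.
    by apply: (nG (f y)); exists y.
  have [|x Gx] := complX G GP.
    apply: cauchy_exP => e e0; have [n ne] := natSinv_lt e0.
    have [i Fi] := sF n.
    have [y Fy] := F0 n.+1.
    have [z [Dz hz zy]] := Fi _ Fy.
    exists z; exists n.+1 => _ [w Fw <-].
    have [z' [Dz' hz' zw]] := Fi _ Fw.
    rewrite ballEmdist /= -(_ : z' = z); first exact: le_lt_trans ne.
    by apply: hinj; rewrite ?inE ?hz ?hz'.
  exists (g x) => n _; have [cC FE] := CP n.
  rewrite FE /= gK; apply: cC => B /Gx[m mB].
  have [y Fy] := F0 (maxn m n).
  exists (f y); split; last first.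
    by apply: mB; exists y => //; exact: le_F (leq_maxl _ _) _ Fy.
  have : F n y by exact: le_F (leq_maxr _ _) _ Fy.
  by rewrite FE.
Qed.

(** * Countably many selectors covering a set with countable sections *)

Section selectors.
Context d (T : measurableType d) (c : nat -> nat -> set T) (cl : set (set T)).
Hypothesis pb : polish_base c cl.
Variable E : set (T * T).
Hypothesis Erefl : forall x, E (x, x).

(** Selectors are total: reflexivity of [E] allows the value [x] wherever nothing better is
    chosen. *)
Definition selector : Type :=
  {f : T -> T | measurable_fun setT f /\ forall x, E (x, f x)}.

Definition selector_id : selector :=
  exist _ id (conj (@measurable_id _ T setT) Erefl).

Definition merge (F : nat -> nat -> selector) (k : nat) : selector :=
  let p : nat * nat := odflt (0%N, 0%N) (unpickle k) in F p.1 p.2.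

Lemma mergeE F n m : merge F (pickle (n, m)) = F n m.
Proof. by rewrite /merge pickleK. Qed.

Definition graphs (F : nat -> selector) : set (T * T) :=
  \bigcup_n [set p | p.2 = sval (F n) p.1].

Lemma graphs_measurable F : measurable (graphs F).
Proof.
apply: bigcup_measurable => n _; apply: (graph_measurable pb).
exact: (svalP (F n)).1.
Qed.

Lemma sub_graphs_merge F n : graphs (F n) `<=` graphs (merge F).
Proof.
by move=> p [m _ pm]; exists (pickle (n, m)) => //=; rewrite mergeE.
Qed.

Variables (A K : seq nat -> set T).
Hypothesis rAK : regular_scheme c cl A K.
Hypothesis EAK : E = suslin_op (fun s => A s `*` K s).

Definition below (s : seq nat) : set (T * T) :=
  suslin_op (fun t => A (s ++ t) `*` K (s ++ t)).

Lemma mkseq_cat (u : nat -> nat) m n :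
  mkseq u (m + n) = mkseq u m ++ mkseq (fun k => u (m + k)%N) n.
Proof.
rewrite /mkseq iotaD map_cat add0n; congr cat.
by rewrite -[m in iota m]addn0 iotaDl -map_comp.
Qed.

Lemma scheme_catl s t : A (s ++ t) `<=` A s /\ K (s ++ t) `<=` K s.
Proof.
have [_ _ dA dK _] := rAK.
elim/last_ind: t => [|t i [IA IK]]; first by rewrite cats0; split.
rewrite -rcons_cat.
by split; [exact: subset_trans (dA _ _) IA|exact: subset_trans (dK _ _) IK].
Qed.

(** Prefixing [s] to a branch of the lower scheme gives a branch [v] of the whole one. Each node of
    [v] is a prefix of a node known to contain the point, so monotonicity suffices. *)
Lemma belowE s : below s `<=` E.
Proof.
move=> p [u up]; rewrite EAK.
exists (fun k => if (k < size s)%N then nth 0%N s k else u (k - size s)%N) => n.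
set v := (fun k => _).
have vs m : mkseq v (size s + m) = s ++ mkseq u m.
  rewrite mkseq_cat; congr cat.
    apply: (@eq_from_nth _ 0%N); rewrite size_mkseq // => k ks.
    by rewrite nth_mkseq // /v ks.
  by apply: eq_mkseq => k; rewrite /v ltnNge leq_addr /= addKn.
have vn : mkseq v (size s + n) = mkseq v n ++ mkseq (fun k => v (n + k)%N) (size s).
  by rewrite addnC mkseq_cat.
have [Ap Kp] := up n; rewrite -vs vn in Ap Kp.
have [sA sK] := scheme_catl (mkseq v n) (mkseq (fun k => v (n + k)%N) (size s)).
by split; [exact: sA|exact: sK].
Qed.

Definition remainder (F : nat -> selector) (s : seq nat) : set (T * T) :=
  below s `\` graphs F.

Lemma remainder_suslin F s : suslin (rectangle cl) (remainder F s).
Proof.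
rewrite /remainder setDE; apply: suslin_setI.
- exact: (rectangle_bigcap pb).
- have [mA cK _ _ _] := rAK.
  by exists (fun t => A (s ++ t) `*` K (s ++ t)) => // t; apply: rectangleX.
- by apply: (measurable_suslin pb); apply: measurableC; exact: graphs_measurable.
Qed.

(** Following the branch of [z] far enough, [K] fits into a small set that contains [z] and is too
    small to contain [y]. *)
Lemma remainder_extend F s x z (y : T) : remainder F s (x, z) -> z <> y ->
  exists t, [/\ (0 < size t)%N, remainder F (s ++ t) (x, z) & ~ K (s ++ t) y].
Proof.
move=> [[u uxz] Fxz] zy; have [n nP] := pb_separate pb zy.
have [_ _ _ _ sK] := rAK.
exists (mkseq u n.+1); split.
- by rewrite size_mkseq.
- split=> //; exists (fun k => u (n.+1 + k)%N) => m.
  by rewrite -catA -mkseq_cat; exact: uxz.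
- have [|i Ki] := sK (s ++ mkseq u n.+1) n.
    by rewrite size_cat size_mkseq addnS ltnS leq_addl.
  move=> /Ki; apply: nP; apply: Ki.
  by have [] := uxz n.+1.
Qed.

(* Baire category: successively avoiding the points of an enumeration of the
   section of [E] produces one more point of that section. *)
Lemma perfect_section_uncountable F x :
  (forall s y, remainder F s (x, y) ->
     exists z z', [/\ z <> z', remainder F s (x, z) & remainder F s (x, z')]) ->
  countable [set y | E (x, y)] -> forall y, ~ remainder F [::] (x, y).
Proof.
move=> split2 cE y0 Ry0.
have [_ _ dA dK sK] := rAK.
have [e eP] : exists e : nat -> T, forall y, E (x, y) -> exists k, e k = y.
  have /countable_injP[f finj] := cE.
  have /choice[e eP] : forall k, exists z, forall y, E (x, y) -> f y = k -> z = y.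
    move=> k; have [[y [Ey fy]]|nex] := pselect (exists y, E (x, y) /\ f y = k).
      exists y => y' Ey' fy'; apply: finj; rewrite ?inE //.
      by rewrite fy.
    by exists y0 => y Ey fy; exfalso; apply: nex; exists y.
  by exists e => y Ey; exists (f y); exact: eP.
pose good s := exists y, remainder F s (x, y).
(* Of two distinct points of the section at a good node, one differs from [e k]; descend towards it
   until [K] excludes [e k]. *)
have /choice[step stepP] : forall sk : seq nat * nat, exists t, good sk.1 ->
    [/\ (0 < size t)%N, good (sk.1 ++ t) & ~ K (sk.1 ++ t) (e sk.2)].
  move=> [s k]; have [[y Ry]|nG] := pselect (good s); last by exists [::].
  have [z [z' [zz' Rz Rz']]] := split2 _ _ Ry.
  have [w [we Rw]] : exists w, w <> e k /\ remainder F s (x, w).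
    have [ze|ze] := pselect (z = e k); last by exists z.
    by exists z'; split => // z'e; apply: zz'; rewrite ze z'e.
  have [t [t0 Rt Kt]] := remainder_extend Rw we.
  by exists t => _; split => //; exists w.
pose node := fix node k :=
  if k is k'.+1 then node k' ++ step (node k', k') else [::].
have good_node k : good (node k).
  elim: k => [|k IH]; first by exists y0.
  by have [] := stepP (node k, k) IH.
(* The steps are nonempty, so the nodes grow and determine an infinite branch [u]. *)
have size_node k : (k <= size (node k))%N.
  elim: k => // k IH; have [t0 _ _] := stepP (node k, k) (good_node k).
  by rewrite /= size_cat -addn1 leq_add.
have node_prefix k j : exists t, node (k + j)%N = node k ++ t.
  elim: j => [|j [t IH]]; first by exists [::]; rewrite addn0 cats0.
  by rewrite addnS /= IH -catA; eexists.
pose u m := nth 0%N (node m.+1) m.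
have node_nth k m : (m < k)%N -> nth 0%N (node k) m = u m.
  move=> mk; have [t] := node_prefix m.+1 (k - m.+1)%N.
  by rewrite subnKC // => ->; rewrite nth_cat size_node.
have nodeE n : exists t, node n = mkseq u n ++ t.
  exists (drop n (node n)); rewrite -[LHS](cat_take_drop n); congr cat.
  apply: (@eq_from_nth _ 0%N); first by rewrite size_takel ?size_mkseq.
  move=> m; rewrite size_takel // => mn.
  by rewrite nth_take // nth_mkseq // node_nth.
have AKnode k : A (node k) x /\ K (node k) !=set0.
  have [y [[v vxy] _]] := good_node k.
  by have := vxy 0%N; rewrite cats0 => -[/= Ax Ky]; split => //; exists y.
have [||y yK Exy] := @regular_scheme_section _ _ _ _ pb A K x u rAK.
- move=> n; have [t nt] := nodeE n.
  by have [Ax _] := AKnode n; rewrite nt in Ax; exact: (scheme_catl _ _).1 Ax.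
- move=> n; have [t nt] := nodeE n.
  have [_ [y Ky]] := AKnode n; rewrite nt in Ky.
  by exists y; exact: (scheme_catl _ _).2 Ky.
(* The limit point [y] is listed as some [e k], yet it lies in [K (node k.+1)], which was chosen to
   avoid [e k]. *)
have [k ky] : exists k, e k = y by apply: eP; rewrite EAK.
have [_ _] := stepP (node k, k) (good_node k); apply.
rewrite /= ky.
pose M := size (node k.+1).
have -> : node k ++ step (node k, k) = mkseq u M.
  apply: (@eq_from_nth _ 0%N); first by rewrite size_mkseq.
  move=> m mM; rewrite nth_mkseq //.
  have [t nt] := node_prefix k.+1 m.+1.
  rewrite -(@node_nth (k.+1 + m.+1)%N m) ?nt ?nth_cat ?mM //.
  by rewrite addnS ltnS leq_addl.
exact: yK.
Qed.

Variables (R : realType) (mu : {finite_measure set T -> \bar R}).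

(** If singleton sections occurred over a set [D] of positive measure, the map [g] selecting their
    only points would be measurable. Adding it to [F] would remove [D] from the projection and lower
    its outer measure, against minimality. *)
Lemma singular_section_null F s :
  (forall F', mu_ext mu (fst @` remainder F s) <=
              mu_ext mu (fst @` remainder F' s))%E ->
  exists N, [/\ measurable N, mu N = 0%E & forall x, ~ N x ->
    forall y, remainder F s (x, y) ->
    exists z z', [/\ z <> z', remainder F s (x, z) & remainder F s (x, z')]].
Proof.
move=> Fmin; pose S := remainder F s.
have sS : suslin (rectangle cl) S := remainder_suslin F s.
have proj U : measurable U -> exists QN : set T * set T,
    [/\ measurable QN.1, measurable QN.2, mu QN.2 = 0%E &
        (QN.1 `<=` fst @` (S `&` (setT `*` U))) /\
        (fst @` (S `&` (setT `*` U)) `<=` QN.1 `|` QN.2)].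
  move=> mU.
  have [|Q [N [? ? ? ? ?]]] := suslin_projection pb mu (S := S `&` (setT `*` U)).
    apply: suslin_setI => //; first exact: (rectangle_bigcap pb).
    by apply: (measurable_suslin pb); exact: measurableX.
  by exists (Q, N).
have mc p : measurable (c p.1 p.2) by exact: (pb_measurable pb).
have [[Q0 N0] /= [mQ0 mN0 N00 [Q0S SQ0]]] := proj _ (@measurableT _ T).
rewrite setXTT setIT in Q0S SQ0.
have /choice[QI IP] := fun p => proj _ (mc p).
have /choice[QO OP] := fun p => proj _ (measurableC (mc p)).
pose W k := (QI (odflt (0%N, 0%N) (unpickle k))).2 `|`
            (QO (odflt (0%N, 0%N) (unpickle k))).2.
pose N := N0 `|` \bigcup_k W k.
have mN : measurable N.
  apply: measurableU => //; apply: bigcup_measurable => k _.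
  apply: measurableU; [by have [] := IP (odflt (0%N, 0%N) (unpickle k))|].
  by have [] := OP (odflt (0%N, 0%N) (unpickle k)).
have N_0 : mu N = 0%E.
  apply/negligibleP => //; apply: negligibleU; first exact/negligibleP.
  apply: negligible_bigcup => k; apply: negligibleU; apply/negligibleP.
  - by have [] := IP (odflt (0%N, 0%N) (unpickle k)).
  - by have [] := IP (odflt (0%N, 0%N) (unpickle k)).
  - by have [] := OP (odflt (0%N, 0%N) (unpickle k)).
  - by have [] := OP (odflt (0%N, 0%N) (unpickle k)).
have NI p x : (QI p).2 x -> N x.
  by move=> Ix; right; exists (pickle p) => //; left; rewrite pickleK.
have NO p x : (QO p).2 x -> N x.
  by move=> Ox; right; exists (pickle p) => //; right; rewrite pickleK.
(* Over [V] the section meets some small set as well as its complement, hence has two points. Over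
   the rest [D] of the projection, off the null set [N], it is a singleton. *)
pose V := \bigcup_n \bigcup_i ((QI (n, i)).1 `&` (QO (n, i)).1).
have mV : measurable V.
  apply: bigcup_measurable => n _; apply: bigcup_measurable => i _.
  by apply: measurableI; [have [] := IP (n, i)|have [] := OP (n, i)].
pose D := (Q0 `\` V) `\` N.
have mD : measurable D by do 2 apply: measurableD => //.
have Dex x : D x -> exists y, S (x, y).
  by move=> [[/Q0S[[x' y] Sxy /= <-] _] _]; exists y.
have Duniq x y z : D x -> S (x, y) -> S (x, z) -> y = z.
  move=> [[Q0x Vx] Nx] Sxy Sxz; apply: contrapT => yz.
  have [n nP] := pb_separate pb yz; have [i ci] := pb_cover pb n y.
  apply: Vx; exists n => //; exists i => //; split.
    have [_ _ _ [_ sub]] := IP (n, i).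
    have [|//|/NI//] := sub x.
    by exists (x, y) => //; split.
  have [_ _ _ [_ sub']] := OP (n, i).
  have [|//|/NO//] := sub' x.
  by exists (x, z) => //; split => //; split => //; exact: nP.
have /choice[g gP] : forall x, exists y, (D x -> S (x, y)) /\ (~ D x -> y = x).
  move=> x; have [Dx|Dx] := pselect (D x); last by exists x.
  by have [y Sxy] := Dex x Dx; exists y.
have mg : measurable_fun setT g.
  apply: measurability; first exact: (pb_generate pb).
  move=> _ [_ [n [i ->]] <-]; rewrite setTI.
  (* A singleton section meets [c n i] exactly when its point [g x] is in it, so on [D] the preimage
     is the measurable kernel of a projection. *)
  rewrite (_ : g @^-1` _ = (D `&` (QI (n, i)).1) `|` (~` D `&` c n i)).
    apply: measurableU; apply: measurableI => //.
    - by have [] := IP (n, i).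
    - exact: measurableC.
    - exact: (pb_measurable pb).
  apply/seteqP; split => x /=.
    have [Dx|Dx] := pselect (D x); last first.
      by rewrite (gP x).2 // => cx; right.
    move=> cgx; left; split => //.
    have [_ _ _ [_ sub]] := IP (n, i).
    have [|//|/NI Nx] := sub x; last by have [_] := Dx.
    by exists (x, g x) => //; split => //; exact: (gP x).1.
  move=> [[Dx Ix]|[Dx cx]]; last by rewrite (gP x).2.
  have [_ _ _ [sub _]] := IP (n, i).
  have [[x' y] [Sxy [_ /= cy]] /= xx'] := sub x Ix; rewrite xx' in Sxy.
  by rewrite (Duniq x (g x) y) //; exact: (gP x).1.
have gE x : E (x, g x).
  have [Dx|Dx] := pselect (D x); last by rewrite (gP x).2.
  by have [Sx _] := (gP x).1 Dx; exact: belowE Sx.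
pose G : selector := exist _ g (conj mg gE).
pose F' := merge (fun n => if n is 0%N then F else (fun=> G)).
have sub : fst @` remainder F' s `<=` (Q0 `|` N) `\` D.
  move=> x [[x' y] [bxy Fxy] /= xx']; rewrite xx' in bxy Fxy.
  have Sxy : S (x, y).
    split => // Gxy; apply: Fxy.
    exact: (@sub_graphs_merge (fun n => if n is 0%N then F else (fun=> G)) 0%N).
  split.
    have [|Q0x|N0x] := SQ0 x; first by exists (x, y).
      by left.
    by right; left.
  move=> Dx; apply: Fxy.
  apply: (@sub_graphs_merge (fun n => if n is 0%N then F else (fun=> G)) 1%N).
  by exists 0%N => //=; apply: (Duniq x) => //; exact: (gP x).1.
(* Comparing [F] with [F'] gives [mu Q0 <= mu Q0 - mu D]. *)
have D0 : mu D = 0%E.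
  have le1 : (mu Q0 <= mu_ext mu (fst @` remainder F s))%E.
    by rewrite -measurable_mu_extE //; exact: le_mu_ext.
  have le2 : (mu_ext mu (fst @` remainder F' s) <= mu ((Q0 `|` N) `\` D))%E.
    rewrite -measurable_mu_extE; first exact: le_mu_ext.
    by apply: measurableD => //; exact: measurableU.
  have := le_trans (le_trans le1 (Fmin F')) le2.
  have -> : mu ((Q0 `|` N) `\` D) = (mu Q0 - mu D)%E.
    rewrite measureD //; last 2 first.
    - exact: measurableU.
    - by rewrite ltey_eq fin_num_measure //; exact: measurableU.
    congr (_ - _)%E; first exact: measureU0.
    by congr (mu _); apply: setIidr => x [[Q0x _] _]; left.
  move=> le; apply/eqP; rewrite eq_le measure_ge0 andbT.
  have fQ : mu Q0 \is a fin_num by exact: fin_num_measure.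
  have fD : mu D \is a fin_num by exact: fin_num_measure.
  move: le; rewrite -(fineK fQ) -(fineK fD) -EFinB !lee_fin => le.
  by rewrite -subr_ge0 in le *; lra.
exists (N `|` D); split.
- exact: measurableU.
- by transitivity (mu N) => //; exact: measureU0.
- move=> x NDx y Sxy.
  have [|Q0x|N0x] := SQ0 x; first by exists (x, y).
    have Vx : V x.
      apply: contrapT => nV; apply: (NDx); right; split; first by split.
      by move=> Nx; apply: NDx; left.
    have [n _ [i _ [Ix Ox]]] := Vx.
    have [_ _ _ [subI _]] := IP (n, i); have [_ _ _ [subO _]] := OP (n, i).
    have [[x1 z] [Sz [_ /= cz]] /= x1E] := subI x Ix.
    have [[x2 z'] [Sz' [_ /= cz']] /= x2E] := subO x Ox.
    rewrite x1E in Sz; rewrite x2E in Sz'.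
    by exists z, z'; split => // zz'; apply: cz'; rewrite -zz'.
  by exfalso; apply: NDx; left; left.
Qed.

Lemma remainder_merge F n s : remainder (merge F) s `<=` remainder (F n) s.
Proof.
by move=> p [bp Fp]; split => // Fnp; apply: Fp; exact: sub_graphs_merge Fnp.
Qed.

Lemma scheme_selectors : (forall x, countable [set y | E (x, y)]) ->
  exists (F : nat -> selector) N, [/\ measurable N, mu N = 0%E &
    forall x y, ~ N x -> E (x, y) -> exists n, sval (F n) x = y].
Proof.
move=> cE.
have /choice[Fs FsP] s := @inf_attained R (nat -> selector) (fun=> selector_id)
  (fun F => mu_ext mu (fst @` remainder F s)) merge
  (fun F n => le_mu_ext mu (image_subset fst (@remainder_merge F n s))).
(* Merging only shrinks remainders, so a single family is optimal at all nodes at once. *)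
pose F := merge (fun k => Fs (CodeSeq.decode k)).
have Fmin s F' : (mu_ext mu (fst @` remainder F s) <=
                  mu_ext mu (fst @` remainder F' s))%E.
  apply: le_trans (FsP s F'); apply: le_mu_ext; apply: image_subset.
  have := @remainder_merge (fun k => Fs (CodeSeq.decode k)) (CodeSeq.code s) s.
  by rewrite CodeSeq.codeK.
have /choice[N NP] s := singular_section_null (Fmin s).
exists F, (\bigcup_k N (CodeSeq.decode k)); split.
- by apply: bigcup_measurable => k _; have [] := NP (CodeSeq.decode k).
- apply/negligibleP; last apply: negligible_bigcup => k.
    by apply: bigcup_measurable => k _; have [] := NP (CodeSeq.decode k).
  by have [? ? _] := NP (CodeSeq.decode k); apply/negligibleP.
- move=> x y Nx Exy; apply: contrapT => nF.
  apply: (@perfect_section_uncountable F x _ (cE x) y).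
    move=> s z Rz; have [_ _] := NP s; apply; last exact: Rz.
    by move=> Nsx; apply: Nx; exists (CodeSeq.code s) => //; rewrite CodeSeq.codeK.
  split; first by move: Exy; rewrite EAK.
  by move=> [n _ /= yF]; apply: nF; exists n.
Qed.

End selectors.

Lemma countable_selectors d (T : measurableType d) c cl
    (pb : polish_base (T := T) c cl) (E : set (T * T))
    (R : realType) (mu : {finite_measure set T -> \bar R}) :
  measurable E -> (forall x, E (x, x)) ->
  (forall x, countable [set y | E (x, y)]) ->
  exists (F : nat -> T -> T) N,
    [/\ forall n, measurable_fun setT (F n), forall n x, E (x, F n x),
        measurable N, mu N = 0%E &
        forall x y, ~ N x -> E (x, y) -> exists n, F n x = y].
Proof.
move=> mE rE cE.
have [A [K [rAK EAK]]] := suslin_regular_scheme pb (measurable_suslin pb mE).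
have [F [N [mN N0 FN]]] := scheme_selectors pb rE rAK EAK mu cE.
exists (fun n => sval (F n)), N; split => // n.
- exact: (svalP (F n)).1.
- exact: (svalP (F n)).2.
Qed.

(** * Invariant conull sets *)

Section bounded_measure.
Context d (T : measurableType d) (R : realType).
Variables (mu : {measure set T -> \bar R}).

(** The finiteness proof is an argument so that a finite measure structure can be attached to the
    term. *)
Definition bounded_measure (_ : (mu setT < +oo)%E) : set T -> \bar R := mu.

Hypothesis mu_fin : (mu setT < +oo)%E.

HB.instance Definition _ := Measure.copy (bounded_measure mu_fin) mu.

Let bounded_measure_fin : fin_num_fun (bounded_measure mu_fin).
Proof. exact/lty_fin_num_fun. Qed.

HB.instance Definition _ := @Measure_isFinite.Build _ _ _
  (bounded_measure mu_fin) bounded_measure_fin.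

Lemma finite_measure_ex :
  exists nu : {finite_measure set T -> \bar R}, forall A, nu A = mu A.
Proof. by exists (bounded_measure mu_fin). Qed.

End bounded_measure.

Lemma finite_pushforward_ex d d' (T : measurableType d) (T' : measurableType d')
    (R : realType) (mu : {finite_measure set T -> \bar R}) (f : T -> T') :
  measurable_fun setT f ->
  exists nu : {finite_measure set T' -> \bar R}, forall A, nu A = mu (f @^-1` A).
Proof.
move=> mf.
pose mu_f : {measure set T' -> \bar R} :=
  measure_function_pushforward__canonical__measure_function_Measure mu mf.
have [|nu nuE] := @finite_measure_ex _ _ _ mu_f.
  by rewrite /= /pushforward preimage_setT ltey_eq fin_num_measure.
by exists nu => A; rewrite nuE.
Qed.

Section quasi_invariance.
Context d (T : measurableType d) (R : realType).
Variables (c : nat -> nat -> set T) (cl : set (set T)).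
Hypothesis pb : polish_base c cl.
Variable E : set (T * T).
Hypothesis hE : countable_borel_equivalence E.

(* [lam w] ranges over the images of [mu] under finitely many selectors, each
   adapted to the previous image.  Hence a set that is null for every [lam w]
   has an E-saturation that is contained in another such set. *)
Lemma invariant_selectors (mu : {finite_measure set T -> \bar R}) :
  exists (F : nat -> T -> T) (X0 : set T),
    [/\ forall n, measurable_fun setT (F n), forall n x, E (x, F n x),
        measurable X0 /\ mu (~` X0) = 0%E,
        forall x y, E (x, y) -> X0 x -> X0 y &
        forall x y, X0 x -> E (x, y) -> exists n, F n x = y].
Proof.
have [mE [rE sE tE] cE] := hE.
have /choice[S SP] : forall nu : {finite_measure set T -> \bar R},
    exists S : (nat -> T -> T) * set T,
    [/\ forall n, measurable_fun setT (S.1 n), forall n x, E (x, S.1 n x),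
        measurable S.2, nu S.2 = 0%E &
        forall x y, ~ S.2 x -> E (x, y) -> exists n, S.1 n x = y].
  move=> nu; have [F [N [? ? ? ? ?]]] := countable_selectors pb nu mE rE cE.
  by exists (F, N).
have /choice[img imgP] : forall nun : {finite_measure set T -> \bar R} * nat,
    exists nu' : {finite_measure set T -> \bar R},
    forall A, nu' A = nun.1 ((S nun.1).1 nun.2 @^-1` A).
  move=> [nu n]; apply: finite_pushforward_ex.
  by have [mF _ _ _ _] := SP nu; exact: mF.
pose lam := fix lam (w : seq nat) : {finite_measure set T -> \bar R} :=
  if w is n :: w' then img (lam w', n) else mu.
pose F w := (S (lam w)).1; pose N w := (S (lam w)).2.
have mF w n : measurable_fun setT (F w n).
  by have [mF _ _ _ _] := SP (lam w); exact: mF.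
have mN w : measurable (N w) by have [] := SP (lam w).
have mpre w n (A : set T) : measurable A -> measurable (F w n @^-1` A).
  by move=> mA; rewrite -[X in measurable X]setTI; exact: mF.
(* Off [N w] the maps [F w n] reach the whole class of a point, so [hull M] contains the saturation
   of [M]. It is null for [lam w] because [M] is null for every [lam (n :: w)]. *)
pose hull M := \bigcap_k (N (CodeSeq.decode k) `|`
                          \bigcup_n (F (CodeSeq.decode k) n @^-1` M)).
have mhull M : measurable M -> measurable (hull M).
  move=> mM; apply: bigcapT_measurable => k; apply: measurableU => //.
  by apply: bigcup_measurable => n _; exact: mpre.
have hull0 M : measurable M -> (forall w, lam w M = 0%E) ->
    forall w, lam w (hull M) = 0%E.
  move=> mM M0 w; apply/negligibleP; first exact: mhull.
  apply: (@negligibleS _ _ _ _ (N w `|` \bigcup_n (F w n @^-1` M))).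
    by move=> x /(_ (CodeSeq.code w) Logic.I); rewrite CodeSeq.codeK.
  apply: negligibleU; first by apply/negligibleP => //; have [] := SP (lam w).
  apply: negligible_bigcup => n; apply/negligibleP; first exact: mpre.
  by have := M0 (n :: w); rewrite /= imgP.
have hullE M x y : E (x, y) -> M x -> hull M y.
  move=> Exy Mx k _; set w := CodeSeq.decode k.
  have [Ny|Ny] := pselect (N w y); [by left|right].
  have [_ _ _ _ FN] := SP (lam w).
  have [n nyx] := FN y x Ny (sE _ _ Exy).
  by exists n => //=; rewrite /F nyx.
pose M := fix M k := if k is k'.+1 then hull (M k') else set0.
have mM k : measurable (M k) by elim: k => //= k IH; exact: mhull.
have M0 k w : lam w (M k) = 0%E.
  by elim: k w => [w|k IH]; [exact: measure0|exact: hull0].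
pose Z := \bigcup_k M k.
have mZ : measurable Z by exact: bigcup_measurable.
have invZ x y : E (x, y) -> Z x -> Z y.
  by move=> Exy [k _ Mx]; exists k.+1 => //; exact: hullE Mx.
exists (fun j => let p := odflt (0%N, 0%N) (unpickle j) in
                 F (CodeSeq.decode p.1) p.2), (~` Z).
split.
- by move=> n; exact: mF.
- move=> n x /=; set w := CodeSeq.decode _.
  by have [_ EF _ _ _] := SP (lam w); exact: EF.
- split; first exact: measurableC.
  rewrite setCK; apply/negligibleP => //; apply: negligible_bigcup => k.
  by apply/negligibleP => //; exact: (M0 k [::]).
- by move=> x y Exy nZx Zy; apply: nZx; apply: invZ Zy; exact: sE.
- move=> x y nZx Exy.
  have [w Nw] : exists w, ~ N w x.
    (* [M 1] is the hull of the empty set, that is, the intersection of all [N w]. *)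
    apply: contrapT => nN; apply: nZx; exists 1%N => // k _; left.
    by apply: contrapT => Nx; apply: nN; exists (CodeSeq.decode k).
  have [_ _ _ _ FN] := SP (lam w).
  have [n nxy] := FN x y Nw Exy.
  by exists (pickle (CodeSeq.code w, n)); rewrite /= pickleK /= CodeSeq.codeK.
Qed.

End quasi_invariance.

(** * Submeasures *)

Section finite_measures.
Context d (T : measurableType d) (R : realType).
Local Open Scope ereal_scope.
Implicit Types mu nu alpha beta : {finite_measure set T -> \bar R}.

Lemma finite_measure_sub alpha beta :
  (forall A, measurable A -> alpha A <= beta A) ->
  exists mu, forall A, measurable A -> beta A = mu A + alpha A.
Proof.
move=> le.
(* [crestr0] vanishes on nonmeasurable sets, which makes the difference nonnegative on all sets. *)
pose nu := crestr0 (cadd (charge_of_finite_measure beta)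
  (copp (charge_of_finite_measure alpha))) (@measurableT _ T).
have nuE A : measurable A -> nu A = beta A - alpha A.
  by move=> mA; rewrite /nu /crestr0 mem_set // /crestr setIT.
have nu0 A : 0 <= nu A.
  have [mA|mA] := pselect (measurable A); last by rewrite /nu /crestr0 memNset.
  by rewrite nuE // sube_ge0 ?le // fin_num_measure.
have [|mu muE] := @finite_measure_ex _ _ _ (measure_of_charge nu nu0).
  change (nu setT < +oo); rewrite nuE // ltey_eq fin_numB.
  by rewrite !fin_num_measure.
exists mu => A mA; rewrite muE; change (beta A = nu A + alpha A).
rewrite nuE // subeK //.
exact: fin_num_measure.
Qed.

(** Use a Hahn decomposition of [alpha - beta]: keep [alpha] on the negative set and [beta] on the
    positive one. With [B] the negative set, the two differences from [mu] are carried by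
    complementary sets. *)
Lemma finite_measure_meet alpha beta : exists mu B,
  [/\ measurable B, forall A, measurable A -> mu A <= alpha A,
      forall A, measurable A -> mu A <= beta A,
      mu B = alpha B & mu (~` B) = beta (~` B)].
Proof.
have [P [N [[mP posP] [mN negN] PN PN0]]] := Hahn_decomposition
  (cadd (charge_of_finite_measure alpha) (copp (charge_of_finite_measure beta))).
have NC : ~` N = P.
  apply/seteqP; split => x; last first.
    by move=> Px Nx; have : (P `&` N) x by []; rewrite PN0.
  by move=> Nx; have [] : (P `|` N) x by rewrite PN.
pose m : {measure set T -> \bar R} := measure_add
  [the {measure set T -> \bar R} of mrestr alpha mN]
  [the {measure set T -> \bar R} of mrestr beta mP].
have mE A : m A = alpha (A `&` N) + beta (A `&` P) by exact: measure_addE.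
have [|mu muE] := @finite_measure_ex _ _ _ m.
  by rewrite mE lte_add_pinfty // ltey_eq fin_num_measure // setTI.
have muNP A : mu A = alpha (A `&` N) + beta (A `&` P) by rewrite muE.
have split2 (nu : {finite_measure set T -> \bar R}) A : measurable A ->
    nu A = nu (A `&` N) + nu (A `&` P).
  by move=> mA; rewrite -NC -setDE addeC -measureDI.
exists mu, N; split => //.
- move=> A mA; rewrite muNP (split2 alpha A mA) leeD2l //.
  have := posP (A `&` P) (measurableI _ _ mA mP) (@subIsetr _ _ _).
  by rewrite /cadd /copp /= sube_ge0 // fin_num_measure //; exact: measurableI.
- move=> A mA; rewrite muNP (split2 beta A mA) leeD2r //.
  have := negN (A `&` N) (measurableI _ _ mA mN) (@subIsetr _ _ _).
  by rewrite /cadd /copp /= sube_le0 // fin_num_measure //; exact: measurableI.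
- by rewrite muNP setIid setIC PN0 measure0 adde0.
- by rewrite NC muNP PN0 setIid measure0 add0e.
Qed.

Lemma density_measure_ex mu (k : T -> \bar R) :
  measurable_fun setT k -> (forall x, 0 <= k x) -> (forall x, k x <= 1) ->
  exists nu, forall A, nu A = \int[mu]_(x in A) k x.
Proof.
move=> mk k0 k1.
pose nu A := \int[mu]_(x in A) k x.
have nu0 : nu set0 = 0 by exact: integral_set0.
have nu_ge0 A : 0 <= nu A by exact: integral_ge0.
have nu_sigma : semi_sigma_additive nu by exact: semi_sigma_additive_nng_induced.
pose nuM : {measure set T -> \bar R} :=
  HB.pack nu (isMeasure.Build _ _ _ nu nu0 nu_ge0 nu_sigma).
apply: (@finite_measure_ex _ _ _ nuM).
apply: (@le_lt_trans _ _ (\int[mu]_(x in setT) (cst 1 x))).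
  by apply: ge0_le_integral => //= x _; rewrite ?k0 ?k1.
by rewrite integral_cst // mul1e ltey_eq fin_num_measure.
Qed.

End finite_measures.

Section lift.
Context d d' (T : measurableType d) (T' : measurableType d') (R : realType).
Local Open Scope ereal_scope.

(* The density of [alpha] is that of [theta] composed with [g]; it is truncated
   at 1 so that [alpha <= mu] holds without exceptional null sets. *)
Lemma lift_submeasure (mu : {finite_measure set T -> \bar R})
    (theta : {finite_measure set T' -> \bar R}) (g : T -> T') :
  measurable_fun setT g ->
  (forall C, measurable C -> theta C <= mu (g @^-1` C)) ->
  exists alpha : {finite_measure set T -> \bar R},
    (forall A, measurable A -> alpha A <= mu A) /\
    (forall C, measurable C -> alpha (g @^-1` C) = theta C).
Proof.
move=> mg le; have [nu nuE] := finite_pushforward_ex mu mg.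
have dom : theta `<< nu.
  apply/null_content_dominatesP => A mA nuA; apply/eqP.
  have := le A mA; rewrite -nuE => leA.
  by rewrite eq_le measure_ge0 andbT (le_trans leA) // nuA.
pose h := Radon_Nikodym_SigmaFinite.f theta nu.
have h0 x : 0 <= h x by exact: Radon_Nikodym_SigmaFinite.f_ge0.
have mh : measurable_fun setT h.
  exact: (measurable_int nu (Radon_Nikodym_SigmaFinite.f_integrable dom)).
have hE C : measurable C -> theta C = \int[nu]_(x in C) h x.
  exact: Radon_Nikodym_SigmaFinite.f_integral.
pose k x := mine (h x) 1.
have mk : measurable_fun setT k by apply: measurable_mine.
have k0 x : 0 <= k x by rewrite /k le_min h0 lee01.
have k1 x : k x <= 1 by rewrite /k ge_min lexx orbT.
pose B := [set x | 1 < h x].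
have mB : measurable B.
  by rewrite -[B]setTI; exact: emeasurable_fun_o_infty.
have kE C : measurable C -> \int[nu]_(x in C) k x = theta C.
  move=> mC.
  have mCB : measurable (C `&` B) by exact: measurableI.
  have mCD : measurable (C `\` B) by exact: measurableD.
  (* On [B] the density exceeds 1, so [theta >= nu], while [theta <= nu] by hypothesis. Hence
     truncating the density loses no mass. *)
  have thetaB : theta (C `&` B) = nu (C `&` B).
    apply/eqP; rewrite eq_le nuE le //= -nuE hE //.
    rewrite -[leLHS]mul1e -integral_cst //.
    apply: ge0_le_integral => //=; first exact: measurable_funTS.
    by move=> x [_ /ltW].
  rewrite -{1}(setUIDK C B) ge0_integral_setU //; last 2 first.
  - exact: measurable_funTS.
  - by apply/disj_setPS => x [[_ Bx] [_]].
  transitivity (theta (C `&` B) + theta (C `\` B)); last first.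
    rewrite -[in RHS](setUIDK C B) measureU //.
    by apply/seteqP; split => // x [[_ Bx] [_]].
  rewrite thetaB hE //; congr (_ + _).
    rewrite -[RHS]mul1e -integral_cst //; apply: eq_integral => x.
    by rewrite inE => -[_ /ltW Bx]; rewrite /k; apply/min_idPr.
  apply: eq_integral => x; rewrite inE => -[_ /negP Bx].
  by rewrite /k; apply/min_idPl; rewrite leNgt.
have [||alpha alphaE] := density_measure_ex mu (measurableT_comp mk mg).
- by move=> x; exact: k0.
- by move=> x; exact: k1.
exists alpha; split => [A mA|C mC].
  rewrite alphaE -[leRHS]mul1e -integral_cst //.
  apply: ge0_le_integral => //=.
    apply: measurable_funTS; exact: measurableT_comp.
rewrite alphaE -ge0_integral_pushforward //; last exact: measurable_funTS.
by rewrite -kE //; apply: eq_measure_integral => A mA _; rewrite /= nuE.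
Qed.

End lift.

(** * The greedy coupling *)

Section greedy_coupling.
Context d (T : measurableType d) (R : realType).
Local Open Scope ereal_scope.

Lemma add_fin_eq0 (x y : \bar R) : y \is a fin_num -> y = x + y -> x = 0.
Proof.
move: x y => [x| |] [y| |] //= _ [yE]; congr (_%:E).
by apply: (addIr y); rewrite -yE add0r.
Qed.

(** [theta] is the meet of [nu] and the image of [mu], [alpha] lifts it to a submeasure of [mu], and
    [eta] carries [alpha] to the graph. On [B] the meet exhausts the image of [mu], and on the
    complement it exhausts [nu]. *)
Lemma graph_coupling (mu nu : {finite_measure set T -> \bar R}) (g : T -> T) :
  measurable_fun setT g ->
  exists (mu' nu' : {finite_measure set T -> \bar R})
    (eta : {finite_measure set (T * T)%type -> \bar R}) (B : set T),
  [/\ measurable B,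
      forall A, measurable A -> mu A = mu' A + eta (fst @^-1` A) /\
                                nu A = nu' A + eta (snd @^-1` A),
      forall S, (forall x, ~ S (x, g x)) -> eta S = 0,
      mu' (g @^-1` B) = 0 & nu' (~` B) = 0].
Proof.
move=> mg.
have mpre A : measurable A -> measurable (g @^-1` A).
  by move=> mA; rewrite -[X in measurable X]setTI; exact: mg.
have [mug mugE] := finite_pushforward_ex mu mg.
have [theta [B [mB le_mug le_nu thetaB thetaCB]]] := finite_measure_meet mug nu.
have [|alpha [le_alpha alphaE]] := @lift_submeasure _ _ _ _ _ mu theta g mg.
  by move=> C mC; rewrite -mugE; exact: le_mug.
have [mu' mu'E] := finite_measure_sub le_alpha.
have [nu' nu'E] := finite_measure_sub le_nu.
have [eta etaE] := finite_pushforward_ex alpha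
  (measurable_fun_pair (@measurable_id _ T setT) mg).
exists mu', nu', eta, B; split => //.
- move=> A mA; split; first by rewrite etaE mu'E.
  by rewrite etaE nu'E // -alphaE.
- move=> S nS; rewrite etaE (_ : _ @^-1` S = set0) ?measure0 //.
  by apply/seteqP; split => x //= /nS.
- apply: (@add_fin_eq0 _ (theta B)); first exact: fin_num_measure.
  by rewrite {1}thetaB mugE mu'E ?alphaE //; exact: mpre.
- apply: (@add_fin_eq0 _ (theta (~` B))).
    by apply: fin_num_measure; exact: measurableC.
  by rewrite {1}thetaCB nu'E //; exact: measurableC.
Qed.

Lemma greedy_coupling (mu nu : {finite_measure set T -> \bar R})
    (F : nat -> T -> T) : (forall n, measurable_fun setT (F n)) ->
  exists (mu' nu' : {finite_measure set T -> \bar R})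
    (gamma : {finite_measure set (T * T)%type -> \bar R}) (B : nat -> set T),
  [/\ forall n, measurable (B n),
      forall A, measurable A -> mu A = mu' A + gamma (fst @^-1` A) /\
                                nu A = nu' A + gamma (snd @^-1` A),
      forall S, (forall n x, ~ S (x, F n x)) -> gamma S = 0,
      forall n, mu' (F n @^-1` B n) = 0 & forall n, nu' (~` B n) = 0].
Proof.
move=> mF.
pose fm := {finite_measure set T -> \bar R}.
pose fm2 := {finite_measure set (T * T)%type -> \bar R}.
have /choice[out outP] : forall sn : (fm * fm) * nat,
    exists o : (fm * fm) * (fm2 * set T),
    [/\ measurable o.2.2,
      forall A, measurable A -> sn.1.1 A = o.1.1 A + o.2.1 (fst @^-1` A) /\
                                sn.1.2 A = o.1.2 A + o.2.1 (snd @^-1` A),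
      forall S, (forall x, ~ S (x, F sn.2 x)) -> o.2.1 S = 0,
      o.1.1 (F sn.2 @^-1` o.2.2) = 0 & o.1.2 (~` o.2.2) = 0].
  move=> [[m1 m2] n]; have [m1' [m2' [eta [B ?]]]] := graph_coupling m1 m2 (mF n).
  by exists ((m1', m2'), (eta, B)).
pose st := fix st n : fm * fm :=
  if n is n'.+1 then (out (st n', n')).1 else (mu, nu).
pose eta n : fm2 := (out (st n, n)).2.1.
pose B n := (out (st n, n)).2.2.
have mB n : measurable (B n) by have [] := outP (st n, n).
have stE n A : measurable A ->
    mu A = (st n).1 A + \sum_(0 <= k < n) eta k (fst @^-1` A) /\
    nu A = (st n).2 A + \sum_(0 <= k < n) eta k (snd @^-1` A).
  move=> mA; elim: n => [|n [-> ->]]; first by rewrite !big_geq // !adde0.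
  have [_ /(_ A mA)[/= -> ->] _ _ _] := outP (st n, n).
  by rewrite !big_nat_recr //= -!addeA; split; congr (_ + _); rewrite addeC.
have etas_le n A : measurable A ->
    \sum_(0 <= k < n) eta k (fst @^-1` A) <= mu A /\
    \sum_(0 <= k < n) eta k (snd @^-1` A) <= nu A.
  by move=> mA; have [-> ->] := stE n A mA; rewrite !leeDr.
(* The plan [gamma] is the sum of all stages; its partial sums have marginals below [mu] and [nu],
   so it is finite. *)
pose series : {measure set (T * T)%type -> \bar R} :=
  mseries (fun k => eta k : {measure set (T * T)%type -> \bar R}) 0.
have series_le S x : (forall n, \sum_(0 <= k < n) eta k S <= x) -> series S <= x.
  move=> le; rewrite /series /= /mseries; apply: lime_le.
    exact: is_cvg_nneseries.
  exact: nearW.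
have [|gamma gammaE] := @finite_measure_ex _ _ _ series.
  apply: (@le_lt_trans _ _ (mu setT)).
    apply: series_le => n; rewrite -(preimage_setT fst).
    by have [] := etas_le n _ measurableT.
  by rewrite ltey_eq fin_num_measure.
have mfst : measurable_fun setT (@fst T T) by exact: measurable_fst.
have msnd : measurable_fun setT (@snd T T) by exact: measurable_snd.
have [g1 g1E] := finite_pushforward_ex gamma mfst.
have [g2 g2E] := finite_pushforward_ex gamma msnd.
have [|mu' mu'E] := @finite_measure_sub _ _ _ g1 mu.
  move=> A mA; rewrite g1E gammaE; apply: series_le => n.
  by have [] := etas_le n A mA.
have [|nu' nu'E] := @finite_measure_sub _ _ _ g2 nu.
  move=> A mA; rewrite g2E gammaE; apply: series_le => n.
  by have [] := etas_le n A mA.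
have partial_le n S : \sum_(0 <= k < n) eta k S <= gamma S.
  by rewrite gammaE; exact: nneseries_lim_ge.
(* The limit residuals lie below those of every stage. The null sets produced at stage [n] concern
   the residuals [st n.+1], so they persist in the limit. *)
have mu'_le n A : measurable A -> mu' A <= (st n).1 A.
  move=> mA; have [] := stE n A mA; rewrite mu'E // g1E => muE _.
  rewrite -(@leeD2rE _ (gamma (fst @^-1` A))).
    by rewrite muE; apply: leeD2l; exact: partial_le.
  by rewrite -g1E fin_num_measure.
have nu'_le n A : measurable A -> nu' A <= (st n).2 A.
  move=> mA; have [] := stE n A mA; rewrite nu'E // g2E => _ nuE.
  rewrite -(@leeD2rE _ (gamma (snd @^-1` A))).
    by rewrite nuE; apply: leeD2l; exact: partial_le.
  by rewrite -g2E fin_num_measure.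
exists mu', nu', gamma, B; split => //.
- by move=> A mA; rewrite -g1E -g2E mu'E // nu'E.
- move=> S nS; rewrite gammaE /series /= /mseries eseries0 // => k _ _.
  by have [_ _ etaS _ _] := outP (st k, k); apply: etaS => x; exact: nS.
- move=> n; apply/eqP; rewrite eq_le measure_ge0 andbT.
  have [_ _ _ /= <- _] := outP (st n, n).
  apply: (mu'_le n.+1); rewrite -[X in measurable X]setTI; exact: mF.
- move=> n; apply/eqP; rewrite eq_le measure_ge0 andbT.
  have [_ _ _ _ /= <-] := outP (st n, n).
  by apply: (nu'_le n.+1); exact: measurableC.
Qed.

End greedy_coupling.

(** * Duality *)

Section duality.
Context d (T : measurableType d) (R : realType).
Local Open Scope ereal_scope.

Lemma invariant_sets_sigma_algebra (E : set (T * T)) :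
  sigma_algebra setT (invariant_sets E).
Proof.
split.
- by split.
- move=> A [mA EA]; rewrite setTD; split; first exact: measurableC.
  by move=> x y /EA[? ?]; split=> /= nA; apply: contra_not nA.
- move=> F EF; split.
    by apply: bigcup_measurable => n _; have [] := EF n.
  move=> x y Exy; split=> -[n _ Fx]; exists n => //;
    by have [_ /(_ x y Exy)[]] := EF n; auto.
Qed.

(** Weak duality: on [E] both coordinates are in [A] or neither is, so the two preimages of [A]
    differ only outside [E]. *)
Lemma dist_le_coupling_cost (E : set (T * T)) (P P' : probability T R)
    (Q : probability (T * T)%type R) (A : set T) :
  measurable E -> (forall x y, E (x, y) -> E (y, x)) ->
  invariant_sets E A -> couplings P P' Q -> `|P A - P' A| <= 1 - Q E.
Proof.
move=> mE sE [mA EA] cQ.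
have mfst : measurable ((fst : T * T -> T) @^-1` A).
  by rewrite -setXT; exact: measurableX.
have msnd : measurable ((snd : T * T -> T) @^-1` A).
  by rewrite -setTX; exact: measurableX.
have mEC := measurableC mE.
have [PA P'A] := cQ A mA; rewrite /pushforward in PA P'A.
have sub2 (S S' : set (T * T)) : measurable S -> measurable S' ->
    S `&` E `<=` S' -> Q S <= Q S' + Q (~` E).
  move=> mS mS' SS'; apply: (le_trans _ (measureU2 Q mS' mEC)).
  apply: le_measure; rewrite ?inE //; first exact: measurableU.
  by move=> p Sp; have [Ep|Ep] := pselect (E p); [left; exact: SS'|right].
have le1 : P A <= P' A + Q (~` E).
  by rewrite -PA -P'A; apply: sub2 => // -[x y] [/= Ax /EA[]]; auto.
have le2 : P' A <= P A + Q (~` E).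
  by rewrite -PA -P'A; apply: sub2 => // -[x y] [/= Ax /EA[]]; auto.
have fP : P A \is a fin_num by exact: fin_num_measure.
have fP' : P' A \is a fin_num by exact: fin_num_measure.
have fQ : Q (~` E) \is a fin_num by exact: fin_num_measure.
rewrite -probability_setC //; move: le1 le2.
rewrite -(fineK fP) -(fineK fP') -(fineK fQ) -EFinB -!EFinD abse_EFin !lee_fin.
by rewrite ler_distl; lra.
Qed.

(* The independent coupling of the residuals, divided by their mass [m], is added
   to [gamma]; if [m = 0] then this adds nothing since [0^-1 = 0]. *)
Lemma complete_coupling (P P' : probability T R)
    (mu nu : {finite_measure set T -> \bar R})
    (gamma : {finite_measure set (T * T)%type -> \bar R}) :
  (forall A, measurable A -> P A = mu A + gamma (fst @^-1` A) /\
                             P' A = nu A + gamma (snd @^-1` A)) ->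
  exists2 Q, couplings P P' Q & forall S, gamma S <= Q S.
Proof.
move=> PE.
have [] := PE _ measurableT; rewrite !probability_setT !preimage_setT => P1 P'1.
have fg : gamma setT \is a fin_num by exact: fin_num_measure.
have fmu A : measurable A -> mu A \is a fin_num by move=> mA; exact: fin_num_measure.
have fnu A : measurable A -> nu A \is a fin_num by move=> mA; exact: fin_num_measure.
pose m := fine (mu setT).
have muT : mu setT = m%:E by rewrite fineK // fmu.
have nuT : nu setT = m%:E.
  rewrite -muT -[LHS](addeK _ fg).
  by rewrite -[in RHS](addeK (mu setT) fg) -P1 -P'1.
have m0 : (0 <= m)%R by rewrite -lee_fin -muT.
have r0 : (0 <= m^-1)%R by rewrite invr_ge0.
pose prod : {measure set (T * T)%type -> \bar R} := (mu \x nu)%E.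
have prodE A B : measurable A -> measurable B ->
    prod (A `*` B) = mu A * nu B by exact: product_measure1E.
pose Qm : {measure set (T * T)%type -> \bar R} := measure_add gamma
  [the {measure set (T * T)%type -> \bar R} of mscale (NngNum r0) prod].
have QE S : Qm S = gamma S + (m^-1)%:E * prod S by exact: measure_addE.
(* If [m = 0], the bounds on [x] force [x = 0]. *)
have cancel (x : \bar R) : x \is a fin_num -> 0 <= x -> x <= m%:E ->
    (m^-1)%:E * (x * m%:E) = x.
  move=> /fineK <-; rewrite !lee_fin -!EFinM => x0 xm; congr (_%:E).
  have [m00|mn0] := eqVneq m 0%R; last by rewrite mulrCA mulVf // mulr1.
  by rewrite m00 !mulr0; apply/eqP; rewrite eq_le x0 -[X in (_ <= X)%R]m00 xm.
have Qfst A : measurable A -> Qm (fst @^-1` A) = P A.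
  move=> mA; rewrite QE -setXT prodE // nuT cancel.
  - by rewrite addeC setXT; have [-> _] := PE A mA.
  - exact: fmu.
  - exact: measure_ge0.
  - by rewrite -muT; apply: le_measure; rewrite ?inE.
have Qsnd A : measurable A -> Qm (snd @^-1` A) = P' A.
  move=> mA; rewrite QE -setTX prodE // muT (muleC m%:E) cancel.
  - by rewrite addeC setTX; have [_ ->] := PE A mA.
  - exact: fnu.
  - exact: measure_ge0.
  - by rewrite -nuT; apply: le_measure; rewrite ?inE.
have QT : Qm setT = 1 by rewrite -(preimage_setT fst) Qfst // probability_setT.
pose Q : probability (T * T)%type R :=
  HB.pack (Qm : set (T * T) -> \bar R) (Measure.class Qm)
    (Measure_isProbability.Build _ _ _ Qm QT).
exists Q; first by move=> A mA; split; [exact: Qfst|exact: Qsnd].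
by move=> S; rewrite [Q S]QE leeDl // mule_ge0.
Qed.

End duality.

(** * An invariant set and a coupling with equal values *)

Section attainment.
Context d (T : measurableType d) (R : realType).
Local Open Scope ereal_scope.

(** The residual [nu] lives on [A], [mu] does not charge [A], and [gamma], being carried by the set
    [E], gives both preimages of [A] the same mass. So the distance at [A] is
    [nu setT = 1 - gamma setT], which bounds the cost of any coupling above [gamma]. *)
Lemma optimal_pair (E : set (T * T)) (P P' : probability T R) :
  standard_borel R T -> countable_borel_equivalence E ->
  exists A (Q : probability (T * T)%type R),
    [/\ invariant_sets E A, couplings P P' Q & 1 - Q E <= `|P A - P' A|].
Proof.
move=> hT hE; have [mE [rE sE tE] cE] := hE.
have [c [cl pb]] := standard_borel_polish_base hT.
pose PP' : {measure set T -> \bar R} := measure_add P P'.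
have PP'E A : PP' A = P A + P' A by exact: measure_addE.
have [|lam lamE] := @finite_measure_ex _ _ _ PP'.
  by rewrite PP'E !probability_setT -EFinD ltry.
have [F [X0 [mF EF [mX0 lamX0] invX0 X0F]]] := invariant_selectors pb hE lam.
have P'X0 : P' (~` X0) = 0.
  apply/eqP; rewrite eq_le measure_ge0 andbT -lamX0 lamE PP'E.
  by rewrite leeDr.
have [mu [nu [gamma [B [mB PE gammaE muB nuB]]]]] := greedy_coupling P P' mF.
have mpre n (C : set T) : measurable C -> measurable (F n @^-1` C).
  by move=> mC; rewrite -[X in measurable X]setTI; exact: mF.
(* [B0] carries [nu], and [A] is its saturation within the invariant set [X0], where the maps [F n]
   exhaust the classes. *)
pose B0 := (\bigcap_n B n) `&` X0.
pose A := X0 `&` \bigcup_n (F n @^-1` B0).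
have mB0 : measurable B0 by apply: measurableI => //; exact: bigcapT_measurable.
have mA : measurable A.
  by apply: measurableI => //; apply: bigcup_measurable => n _; exact: mpre.
have invA x y : E (x, y) -> A x -> A y.
  move=> Exy [X0x [n _ Bn]]; split; first exact: invX0 X0x.
  have [k ky] := X0F y (F n x) (invX0 _ _ Exy X0x) (tE _ _ _ (sE _ _ Exy) (EF n x)).
  by exists k => //=; rewrite ky.
have EA : invariant_sets E A.
  by split => // x y Exy; split; apply: invA => //; exact: sE.
have muA : mu A = 0.
  apply: (@subset_measure0 _ _ _ _ A (\bigcup_n (F n @^-1` B n))) => //.
  - by apply: bigcup_measurable => n _; exact: mpre.
  - by move=> x [_ [n _ [Bx _]]]; exists n => //; exact: Bx.
  - apply/negligibleP; first by apply: bigcup_measurable => n _; exact: mpre.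
    by apply: negligible_bigcup => n; apply/negligibleP; [exact: mpre|exact: muB].
have nuX0 : nu (~` X0) = 0.
  apply/eqP; rewrite eq_le measure_ge0 andbT -P'X0.
  by have [_ ->] := PE _ (measurableC mX0); rewrite leeDl.
have nuCA : nu (~` A) = 0.
  apply: (@subset_measure0 _ _ _ _ (~` A) ((\bigcup_n ~` B n) `|` ~` X0)) => //.
  - exact: measurableC.
  - apply: measurableU; last exact: measurableC.
    by apply: bigcup_measurable => n _; exact: measurableC.
  - move=> x nAx; have [X0x|] := pselect (X0 x); last by right.
    left; apply: contrapT => nBx; apply: nAx; split => //.
    have [n nx] := X0F x x X0x (rE x); exists n => //; rewrite /= nx; split => //.
    by move=> k _; apply: contrapT => nBk; apply: nBx; exists k.
  - apply/negligibleP.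
      apply: measurableU; last exact: measurableC.
      by apply: bigcup_measurable => n _; exact: measurableC.
    apply: negligibleU; last by apply/negligibleP => //; exact: measurableC.
    apply: negligible_bigcup => n.
    by apply/negligibleP; [exact: measurableC|exact: nuB].
have gammaCE : gamma (~` E) = 0 by apply: gammaE => n x; apply.
have fg S : measurable S -> gamma S \is a fin_num by exact: fin_num_measure.
have gammaI S : measurable S -> gamma S = gamma (S `&` E).
  move=> mS; apply/eqP; rewrite eq_le; apply/andP; split; last first.
    by apply: le_measure; rewrite ?inE //; exact: measurableI.
  have mSE : measurable (S `&` E) by exact: measurableI.
  have mCE := measurableC mE.
  rewrite -[leRHS]adde0 -gammaCE; apply: (le_trans _ (measureU2 gamma mSE mCE)).
  apply: le_measure; rewrite ?inE //; first exact: measurableU.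
  by move=> p Sp; have [?|?] := pselect (E p); [left|right].
have gammaA : gamma (fst @^-1` A) = gamma (snd @^-1` A).
  rewrite gammaI; last by rewrite -setXT; exact: measurableX.
  rewrite [RHS]gammaI; last by rewrite -setTX; exact: measurableX.
  congr (gamma _); apply/seteqP; split => -[x y] [/= xA Exy]; split => //=.
    exact: invA xA.
  by apply: invA xA; exact: sE.
have nuA : nu A = nu setT.
  transitivity (nu A + nu (~` A)); first by rewrite nuCA adde0.
  rewrite -(setUv A) measureU ?setICr //; exact: measurableC.
have [Q cQ leQ] := complete_coupling PE.
exists A, Q; split => //.
have [-> ->] := PE A mA; rewrite muA add0e gammaA nuA.
have nu1 : 1 = nu setT + gamma setT.
  rewrite -(probability_setT P'); have [_] := PE _ measurableT.
  by rewrite preimage_setT.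
have QE : gamma setT <= Q E.
  by rewrite gammaI // setTI; exact: leQ.
have fT := fg _ measurableT.
have fnu : nu setT \is a fin_num by exact: fin_num_measure.
have fA : gamma (snd @^-1` A) \is a fin_num.
  by apply: fg; rewrite -setTX; exact: measurableX.
apply: (@le_trans _ _ (1 - gamma setT)); first exact: leeB.
rewrite nu1 addeK // fin_num_oppeD // addeCA subee // adde0 abseN.
by rewrite gee0_abs.
Qed.

End attainment.

Theorem corollary3p19 (R : realType) (d : measure_display)
    (T : measurableType d) (hT : standard_borel R T)
    (E : set (T * T)) (hE : countable_borel_equivalence E) :
  strongly_dualizable R E.
Proof.
have [mE [_ sE _] _] := hE.
split => //; [exact: invariant_sets_sigma_algebra|by move=> A []|].
move=> P P'; have [A [Q [EA cQ leAQ]]] := optimal_pair P P' hT hE.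
(* As every distance is at most every cost, the pair [A], [Q] is optimal on both sides. *)
have weak A' Q' : invariant_sets E A' -> couplings P P' Q' ->
    (`|P A' - P' A'| <= 1 - Q' E)%E.
  exact: dist_le_coupling_cost.
have costE : (1 - Q E)%E = `|P A - P' A|%E.
  by apply/eqP; rewrite eq_le leAQ weak.
have supE : ereal_sup (tv_values (invariant_sets E) P P') = `|P A - P' A|%E.
  apply/eqP; rewrite eq_le; apply/andP; split.
    by apply: ge_ereal_sup => _ [A' EA' <-]; rewrite -costE; exact: weak.
  by apply: ereal_sup_ubound; exists A.
have infE : ereal_inf (coupling_costs E P P') = `|P A - P' A|%E.
  apply/eqP; rewrite eq_le; apply/andP; split.
    by apply: ereal_inf_lbound; exists Q.
  by apply: le_ereal_inf_tmp => _ [Q' cQ' <-]; exact: weak.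
rewrite supE infE; split => //; [by exists A|by exists Q].
Qed.
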